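(* Let $A\in\mathbb{R}_{\max}^{d\times d}$ be irreducible and let $\gamma$ be the cyclicity of $\mathcal{G}(A)$. Let $B$ be a matrix obtained from $A$ by setting some entries to $-\infty$, and suppose that there is a completely reducible subgraph $\mathcal{G}$ of $\mathcal{G}(A)$ (containing at least one cycle) such that $$T_1(A,B)\le \max\left\{T_{cr}^{l(Z)}(A,Z)+1 \;:\; Z \text{ a cycle in } \mathcal{G}\right\},$$ where $l(Z)$ is the length of $Z$. Then $$T_1(A,B)\le \gamma\left(\left\lfloor\frac{d}{\gamma}\right\rfloor-1\right)^2+d+\gamma .$$ In particular, this bound holds for $B=B_{\mathrm{CT}}[A]$.
   Context: Max-plus algebra: $\mathbb{R}_{\max}=\mathbb{R}\cup\{-\infty\}$ with $a\oplus b=\max(a,b)$ and $a\otimes b=a+b$, extended to matrices by $(A\oplus B)_{ij}=a_{ij}\oplus b_{ij}$ and $(AB)_{ij}=(A\otimes B)_{ij}=\bigoplus_k a_{ik}\otimes b_{kj}$. $A^t$ is the $t$-th max-plus power, $A^0=I$ (entries $0$ on the diagonal, $-\infty$ elsewhere); $\lambda^{\otimes t}=t\lambda$ for a scalar, and $\mu\otimes A$ adds $\mu$ to every entry. Graphs: $\mathcal{G}(A)$ is the weighted digraph with nodes $1,\dots,d$ and an arc $(i,j)$ of weight $a_{ij}$ whenever $a_{ij}\ne-\infty$. The length $l(W)$ of a walk $W$ is its number of arcs. A cycle is a closed walk with at least one arc and no repeated node other than its coinciding ends. $A$ is irreducible if $\mathcal{G}(A)$ is strongly connected; the $1\times1$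 matrix $(-\infty)$ is excluded, so that the maximum cycle mean $\lambda(A)$ (the maximum over all cycles of weight divided by length) is finite. The critical graph $\mathcal{G}^c(A)$ consists of all nodes and arcs of cycles with mean weight $\lambda(A)$. A digraph is completely reducible if it is a disjoint union of strongly connected components (s.c.c.) with no arcs between different components. The cyclicity of a strongly connected digraph is the gcd of the lengths of its cycles; the cyclicity of a completely reducible digraph is the lcm of the cyclicities of its components. CSR terms: let $\sigma$ be the cyclicity of $\mathcal{G}^c(A)$ and $M=\left(((-\lambda(A))\otimes A)^{\sigma}\right)^*$, where $N^*=\bigoplus_{i\ge0}N^i$. Define $C,S,R$ by: $c_{ij}=m_{ij}$ if $j$ is a node of $\mathcal{G}^c(A)$ and $-\infty$ otherwise; $r_{ij}=m_{ij}$ if $i$ is a node of $\mathcal{G}^c(A)$ and $-\infty$ otherwise; $s_{ij}=a_{ij}-\lambda(A)$ if $(i,j)$ is an arc of $\mathcal{G}^c(A)$ and $-\infty$ otherwise. $T_1(A,B)$ is the smallest nonnegative integer $T$ such that $A^t=\left(\lambda(A)^{\otimes t}\otimes CS^tR\right)\oplus B^t$ for all $t\ge T$. Cycle removal threshold: for a subgraph $\mathcal{H}$ of $\mathcal{G}(A)$ and a positive integer $\sigma$, $T_{cr}^{\sigma}(A,\mathcal{H})$ is the smallest nonnegative integer $T$ such that: for all nodes $i,j$ and each walk $W$ on $\mathcal{G}(A)$ from $i$ to $j$ that goes through a node of $\mathcal{H}$ and has length $\ge T$, there is a walk $V$ from $i$ to $j$ going through a node of $\mathcal{H}$, obtained from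 $W$ by removing cycles and possibly inserting cycles of $\mathcal{H}$, such that $l(V)\equiv l(W)\pmod\sigma$ and $l(V)\le T$. A cycle $Z$ is regarded as a subgraph. Cycle Threshold scheme: for $\mu\in\mathbb{R}_{\max}$ let $\mathcal{T}^{ct}(\mu)$ be the subgraph of $\mathcal{G}(A)$ consisting of all nodes and arcs belonging to cycles of $\mathcal{G}(A)$ with mean weight $\ge\mu$. Let $\mu^{ct}$ be the maximum of $\mu\le\lambda(A)$ such that $\mathcal{T}^{ct}(\mu)$ has an s.c.c. that does not contain any s.c.c. of $\mathcal{G}^c(A)$; if no such $\mu$ exists, $\mu^{ct}=-\infty$ and $\mathcal{T}^{ct}(\mu^{ct})=\mathcal{G}(A)$. Let $\mathcal{G}^{ct}$ be the union of the s.c.c.'s of $\mathcal{T}^{ct}(\mu^{ct})$ intersecting $\mathcal{G}^c(A)$. Then $B_{\mathrm{CT}}[A]$ has entry $-\infty$ at $(i,j)$ if $i$ or $j$ is a node of $\mathcal{G}^{ct}$, and $a_{ij}$ otherwise. *)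

(* Defs.v *)
From mathcomp Require Import all_boot all_order all_algebra.
From mathcomp Require Import all_classical all_reals all_analysis.
Set Implicit Arguments.
Unset Strict Implicit.
Unset Printing Implicit Defensive.
Import Order.TTheory GRing.Theory Num.Theory.
Local Open Scope classical_set_scope.
Local Open Scope ring_scope.
Local Open Scope ereal_scope.

(* R_max is the part of \bar R below +oo, with maxe as sum and the addition of
   \bar R as product (-oo is absorbing for the latter, even against +oo). *)
Definition over_Rmax (R : realType) (d : nat) (A : 'M[\bar R]_d) : Prop :=
  forall i j, A i j != +oo.

Section MaxPlus.
Variables (R : realType) (d : nat).
Implicit Types (A B : 'M[\bar R]_d).

Definition mp_add A B : 'M[\bar R]_d := \matrix_(i, j) maxe (A i j) (B i j).

Definition mp_mul A B : 'M[\bar R]_d :=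
  \matrix_(i, j) \big[maxe/-oo]_k (A i k + B k j).

Definition mp_one : 'M[\bar R]_d := \matrix_(i, j) (if i == j then 0 else -oo).

Definition mp_pow A (t : nat) : 'M[\bar R]_d := iter t (mp_mul A) mp_one.

Definition mp_scale (mu : \bar R) A : 'M[\bar R]_d :=
  \matrix_(i, j) (mu + A i j).

Definition mp_star A : 'M[\bar R]_d :=
  \matrix_(i, j) ereal_sup (range (fun t => mp_pow A t i j)).

Definition erased A B : Prop := forall i j, B i j = A i j \/ B i j = -oo.

End MaxPlus.

(* The least element of P if P is nonempty, and +oo otherwise. *)
Definition least_nat (R : realType) (P : nat -> Prop) : \bar R :=
  ereal_inf [set n%:R%:E | n in [set n | P n]].

Record digraph (d : nat) := Digraph { nodes : {set 'I_d}; arc : rel 'I_d }.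

Section Digraphs.
Variable d : nat.
Implicit Types (G H : digraph d) (c p : seq 'I_d).

Definition subgraph H G : Prop :=
  [/\ nodes H \subset nodes G, subrel (arc H) (arc G) &
      forall x y, arc H x y -> x \in nodes H /\ y \in nodes H].

(* A cycle is the sequence of its distinct nodes, from an arbitrary one of
   them; its length is the size of the sequence. Cycles have at most d nodes,
   so that d.-bseq 'I_d is a finite type containing all of them. *)
Definition is_cycle G c : bool := [&& c != [::], uniq c & path.cycle (arc G) c].

Definition cycle_graph c : digraph d :=
  Digraph [set x in c] (fun x y => (x \in c) && (next c x == y)).

Definition strongly_connected G : Prop :=
  {in nodes G &, forall x y, connect (arc G) x y}.

Definition same_scc G (x y : 'I_d) : bool :=
  connect (arc G) x y && connect (arc G) y x.

Definition sccs G : {set {set 'I_d}} :=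
  equivalence_partition (same_scc G) (nodes G).

Definition completely_reducible G : Prop :=
  forall x y, arc G x y -> same_scc G x y.

Definition induced G (X : {set 'I_d}) : digraph d :=
  Digraph (nodes G :&: X) (fun x y => [&& arc G x y, x \in X & y \in X]).

(* sc_cyclicity is meant for strongly connected digraphs, cyclicity for
   completely reducible ones. *)
Definition sc_cyclicity G : nat :=
  \big[gcdn/0%N]_(c : d.-bseq 'I_d | is_cycle G c) size c.

Definition cyclicity G : nat :=
  \big[lcmn/1%N]_(X in sccs G) sc_cyclicity (induced G X).

(* The walk visiting i and then the nodes of p has length size p. *)
Definition walk G (i j : 'I_d) p : bool := path (arc G) i p && (last i p == j).

Definition goes_through H (i : 'I_d) p : bool := has (mem (nodes H)) (i :: p).

Definition walk_arcs (i : 'I_d) p : seq ('I_d * 'I_d) := zip (i :: p) p.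

Definition cycle_arcs c : seq ('I_d * 'I_d) := [seq (x, next c x) | x <- c].

(* The walk i :: q is obtained from i :: p by removing the cycles in rs and
   inserting cycles zs of H. Removal and insertion act on the multiset of arcs
   traversed: what is left need not be traversed in the original order. *)
Definition cycle_edit G H (i : 'I_d) p q : Prop :=
  exists (kept : seq ('I_d * 'I_d)) (rs zs : seq (seq 'I_d)),
    [/\ all (is_cycle G) rs, all (is_cycle H) zs,
        perm_eq (walk_arcs i p) (kept ++ flatten (map cycle_arcs rs)) &
        perm_eq (walk_arcs i q) (kept ++ flatten (map cycle_arcs zs))].

End Digraphs.

Section WeightedDigraph.
Variables (R : realType) (d : nat).
Implicit Types (A B : 'M[\bar R]_d) (c : seq 'I_d) (mu : \bar R).

Definition graph A : digraph d := Digraph [set: 'I_d]%SET (fun i j => A i j != -oo).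

Definition irreducible A : Prop :=
  [/\ (0 < d)%N, strongly_connected (graph A) &
      ~ (d = 1%N /\ forall i j, A i j = -oo)].

Definition cycle_mean A c : \bar R :=
  (\sum_(x <- c) A x (next c x)) * ((size c)%:R^-1)%:E.

Definition max_cycle_mean A : \bar R :=
  \big[maxe/-oo]_(c : d.-bseq 'I_d | is_cycle (graph A) c) cycle_mean A c.

Definition cycle_span A (P : pred (seq 'I_d)) : digraph d :=
  Digraph
    [set x | [exists c : d.-bseq 'I_d,
                [&& is_cycle (graph A) c, P c & x \in val c]]]%SET
    (fun x y => [exists c : d.-bseq 'I_d,
                [&& is_cycle (graph A) c, P c, x \in val c & next c x == y]]).

Definition critical_graph A : digraph d :=
  cycle_span A (fun c => cycle_mean A c == max_cycle_mean A).

Definition csr_M A : 'M[\bar R]_d :=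
  mp_star (mp_pow (mp_scale (- max_cycle_mean A) A)
                  (cyclicity (critical_graph A))).

Definition csr_C A : 'M[\bar R]_d :=
  \matrix_(i, j) (if j \in nodes (critical_graph A) then csr_M A i j else -oo).

Definition csr_S A : 'M[\bar R]_d :=
  \matrix_(i, j)
    (if arc (critical_graph A) i j then A i j - max_cycle_mean A else -oo).

Definition csr_R A : 'M[\bar R]_d :=
  \matrix_(i, j) (if i \in nodes (critical_graph A) then csr_M A i j else -oo).

Definition csr A (t : nat) : 'M[\bar R]_d :=
  mp_mul (mp_mul (csr_C A) (mp_pow (csr_S A) t)) (csr_R A).

Definition T1 A B : \bar R :=
  least_nat R (fun T => forall t, (T <= t)%N ->
    mp_pow A t =
    mp_add (mp_scale (t%:R%:E * max_cycle_mean A) (csr A t)) (mp_pow B t)).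

Definition Tcr (sigma : nat) A (H : digraph d) : \bar R :=
  least_nat R (fun T => forall (i j : 'I_d) (p : seq 'I_d),
    walk (graph A) i j p -> goes_through H i p -> (T <= size p)%N ->
    exists q : seq 'I_d,
      [/\ walk (graph A) i j q, goes_through H i q,
          cycle_edit (graph A) H i p q,
          size q = size p %[mod sigma] & (size q <= T)%N]).

Definition Tct A mu : digraph d :=
  cycle_span A (fun c => mu <= cycle_mean A c).

(* As mu <= max_cycle_mean A, critical_graph A is a subgraph of Tct A mu, and
   containment of components can be tested on their node sets. *)
Definition ct_admissible A mu : Prop :=
  mu <= max_cycle_mean A /\
  exists2 X, X \in sccs (Tct A mu) &
    forall Y, Y \in sccs (critical_graph A) -> ~~ (Y \subset X).

(* The supremum is a maximum when it is taken over a nonempty set, since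
   Tct A mu only changes when mu exceeds a cycle mean; it is -oo otherwise. *)
Definition mu_ct A : \bar R := ereal_sup [set mu | ct_admissible A mu].

Definition ct_graph A : digraph d :=
  if `[< exists mu, ct_admissible A mu >] then Tct A (mu_ct A) else graph A.

Definition Gct_nodes A : {set 'I_d} :=
  (\bigcup_(X in sccs (ct_graph A) |
            X :&: nodes (critical_graph A) != finset.set0) X)%SET.

Definition B_CT A : 'M[\bar R]_d :=
  \matrix_(i, j)
    (if (i \in Gct_nodes A) || (j \in Gct_nodes A) then -oo else A i j).

End WeightedDigraph.

(* Main.v *)
Require Import Defs.
From mathcomp Require Import all_boot all_order all_algebra.
From mathcomp Require Import all_classical all_reals all_analysis.
From mathcomp Require Import zify ring lra.
(* Again, since [path.arc] has shadowed [Defs.arc]. *)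
Import Defs.
Set Implicit Arguments.
Unset Strict Implicit.
Unset Printing Implicit Defensive.
Import Order.TTheory GRing.Theory Num.Theory.

(* Let g be the cyclicity, r = d / g, N = g (r - 1)^2 + d + g - 1, and let Z be
   a cycle of length g m. Every walk through Z can be cut down to length at most
   N. All cycle lengths are multiples of g, and some cyclic class K has at most
   r nodes; it is visited every g steps.
   - If m < r, a shortest walk visits a node of K at most m times before
     reaching Z and at most m times afterwards, as otherwise two visits are
     congruent modulo g m; and if it visits it afterwards, then at most once
     before, because cycles can be moved to the later visit. This bounds the
     number of visits to K.
   - If m = r, then K lies in Z, so that all cycles meet Z. The walk splits into
     a short base walk and cycles, fewer than m of which are kept, by a
     pigeonhole on partial sums. If a kept cycle misses the base then Z is
     inserted, making everything connected; the room for Z is provided by that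
     cycle and the base being disjoint.
   Hence T_cr <= N.

   For B_CT, a walk of length t > N avoiding G^ct is a walk of B_CT. Otherwise
   its cycles are exchanged for better ones, without changing the length, until
   the walk meets the critical graph, where it contributes to C S^t R. Conversely
   a CSR term is realized by a walk through a critical cycle whose length is
   right modulo the length of that cycle, and is then reduced and padded to
   length t. *)

(** * Walks, cycles and multisets of arcs *)

Section Walks.
Variables (d : nat) (G : digraph d).
Implicit Types (x y z : 'I_d) (p q c : seq 'I_d) (cs : seq (seq 'I_d)).

Definition arcs_of cs := flatten (map (@cycle_arcs d) cs).

Definition cycle_sizes cs := sumn (map size cs).

Lemma walk_arcs_cons x y p : walk_arcs x (y :: p) = (x, y) :: walk_arcs y p.
Proof. by []. Qed.

Lemma walk_arcs_cat x p q :
  walk_arcs x (p ++ q) = walk_arcs x p ++ walk_arcs (last x p) q.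
Proof. by elim: p x => [|y p IH] x //=; rewrite /walk_arcs /= -IH. Qed.

Lemma size_walk_arcs x p : size (walk_arcs x p) = size p.
Proof. by rewrite size_zip /=; apply/minn_idPr. Qed.

Lemma mem_walk_arcs_fst x p a : a \in walk_arcs x p -> a.1 \in x :: p.
Proof.
elim: p x => [|y p IH] x //; rewrite walk_arcs_cons !inE => /orP[/eqP->|/IH].
  by rewrite eqxx.
by rewrite inE => ->; rewrite orbT.
Qed.

Lemma mem_walk_arcs_snd x p a : a \in walk_arcs x p -> a.2 \in p.
Proof.
elim: p x => [|y p IH] x //; rewrite walk_arcs_cons !inE => /orP[/eqP->|/IH->].
  by rewrite eqxx.
by rewrite orbT.
Qed.

Lemma size_arcs_of cs : size (arcs_of cs) = cycle_sizes cs.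
Proof.
rewrite size_flatten /shape -map_comp; congr sumn.
by apply: eq_map => c /=; rewrite size_map.
Qed.

Lemma arcs_of_cons c cs : arcs_of (c :: cs) = cycle_arcs c ++ arcs_of cs.
Proof. by []. Qed.

Lemma arcs_of_cat cs1 cs2 : arcs_of (cs1 ++ cs2) = arcs_of cs1 ++ arcs_of cs2.
Proof. by rewrite /arcs_of map_cat flatten_cat. Qed.

Lemma perm_arcs_of cs1 cs2 : perm_eq cs1 cs2 -> perm_eq (arcs_of cs1) (arcs_of cs2).
Proof. by move=> cs12; apply/perm_flatten/perm_map. Qed.

Lemma cycle_arcs_walk x p : uniq (x :: p) ->
  cycle_arcs (x :: p) = walk_arcs x (rcons p x).
Proof.
have fpath_arcs (f : 'I_d -> 'I_d) y s : fpath f y s ->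
    walk_arcs y s = [seq (z, f z) | z <- belast y s].
  elim: s y => [|z s IH] y //= /andP[/eqP <- fs].
  by rewrite walk_arcs_cons IH.
by move=> /cycle_next fp; rewrite (fpath_arcs _ _ _ fp) belast_rcons.
Qed.

Lemma perm_cycle_arcs_rot n c : uniq c -> perm_eq (cycle_arcs (rot n c)) (cycle_arcs c).
Proof.
move=> uc; rewrite /cycle_arcs; under eq_map => x do rewrite next_rot //.
by apply/perm_map; rewrite perm_rot.
Qed.

Lemma cycle_from c x : is_cycle G c -> x \in c -> exists p,
  [/\ path (arc G) x p, last x p = x, size p = size c, p =i c &
      perm_eq (walk_arcs x p) (cycle_arcs c)].
Proof.
move=> /and3P[_ uc cc] xc; case: (rot_to xc) => n s rs.
exists (rcons s x); split; last 1 first.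
- by rewrite -cycle_arcs_walk -rs ?rot_uniq // perm_cycle_arcs_rot.
- by move: cc; rewrite -(rot_cycle n) rs.
- by rewrite last_rcons.
- by rewrite -(size_rot n c) rs size_rcons.
- by move=> y; rewrite -(mem_rot n c) rs mem_rcons inE.
Qed.

Lemma cycle_pos c : is_cycle G c -> 0 < size c.
Proof. by case: c. Qed.

(** Induction from the far end of the walk: when the new first node already lies on the simple path
    obtained so far, the stretch leading back to it closes a cycle, which is split off. *)
Lemma loop_erasure x p : path (arc G) x p -> exists p' cs,
  [/\ path (arc G) x p', last x p' = last x p, uniq (x :: p'),
      all (is_cycle G) cs &
      perm_eq (walk_arcs x p) (walk_arcs x p' ++ arcs_of cs)].
Proof.
elim: p x => [|y p IH] x /=; first by exists [::], [::]; split.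
case/andP=> exy /IH[p' [cs [pp' lp' up' ccs arcsp]]].
have [xp'|xp'] := boolP (x \in y :: p'); last first.
  exists (y :: p'), cs; split=> //=; first by rewrite exy.
    by move: xp' up' => /= -> ->.
  by rewrite !walk_arcs_cons perm_cons.
move/splitPr: xp' => sE.
have [s1 [s2 Es]] : exists s1 s2, y :: p' = s1 ++ x :: s2.
  by case: sE => s1 s2; exists s1, s2.
have px : path (arc G) x (s1 ++ x :: s2) by rewrite -Es /= exy.
have us : uniq (s1 ++ x :: s2) by rewrite -Es.
have pxr : path (arc G) x (rcons s1 x ++ s2) by rewrite cat_rcons.
move: (pxr); rewrite cat_path last_rcons => /andP[px1 px2].
have u1 : uniq (x :: s1).
  by move: us; rewrite -cat_rcons cat_uniq rcons_uniq => /andP[].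
exists s2, ((x :: s1) :: cs); split=> //.
- by rewrite -lp'; change (last x s2 = last x (y :: p')); rewrite Es last_cat.
- by move: us; rewrite cat_uniq => /and3P[].
- by rewrite /= {1}/is_cycle /= px1 ccs andbT; move: u1 => /= ->.
rewrite walk_arcs_cons.
rewrite arcs_of_cons cycle_arcs_walk //.
apply: (@perm_trans _ ((x, y) :: (walk_arcs y p' ++ arcs_of cs))).
  by rewrite perm_cons.
have -> : (x, y) :: (walk_arcs y p' ++ arcs_of cs) =
          walk_arcs x (y :: p') ++ arcs_of cs by [].
rewrite Es -cat_rcons walk_arcs_cat last_rcons catA perm_cat2r.
by rewrite perm_catC.
Qed.

(** Arcs are compared as multisets, so rearranging a walk, or moving a closed subwalk to another
    visit of the same node, also counts as a reduction. *)
Definition reduces x p q := exists2 cs, all (is_cycle G) cs &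
  perm_eq (walk_arcs x p) (walk_arcs x q ++ arcs_of cs).

Lemma reduces_refl x p : reduces x p p.
Proof. by exists [::] => //; rewrite cats0. Qed.

Lemma reduces_trans x p q r : reduces x p q -> reduces x q r -> reduces x p r.
Proof.
move=> [cs1 c1 p1] [cs2 c2 p2]; exists (cs2 ++ cs1); first by rewrite all_cat c2.
rewrite arcs_of_cat catA (perm_trans p1) //.
by rewrite perm_cat2r.
Qed.

Lemma closed_walk_cycles x p : path (arc G) x p -> last x p = x -> exists2 cs,
  all (is_cycle G) cs & perm_eq (walk_arcs x p) (arcs_of cs).
Proof.
move=> /loop_erasure[p' [cs [_ lp' up' ccs E]]] lx; exists cs => //.
move: lp' up' E; rewrite lx; case: p' => [|y p'] //= <-.
by rewrite mem_last.
Qed.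

Lemma reduces_perm x p q : perm_eq (walk_arcs x p) (walk_arcs x q) -> reduces x p q.
Proof. by move=> pq; exists [::] => //; rewrite cats0. Qed.

Lemma reduces_cut x p q s : path (arc G) (last x p) q ->
  last (last x p) q = last x p -> reduces x (p ++ q ++ s) (p ++ s).
Proof.
move=> pq lq; have [cs ccs E] := closed_walk_cycles pq lq; exists cs => //.
rewrite !walk_arcs_cat lq -catA perm_cat2l.
by rewrite perm_catC perm_cat2l.
Qed.

(** A detour around [c] is taken at a common node. No node of the walk is lost, which lets several
    cycles be spliced in turn. *)
Lemma splice x p c : path (arc G) x p -> is_cycle G c -> has (mem c) (x :: p) ->
  exists q, [/\ path (arc G) x q, last x q = last x p,
    {subset x :: p <= x :: q}, {subset c <= x :: q} &
    perm_eq (walk_arcs x q) (walk_arcs x p ++ cycle_arcs c)].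
Proof.
move=> pp cc /hasP[y yp yc].
have [p1 [p2 [Ep ly]]] : exists p1 p2, p = p1 ++ p2 /\ last x p1 = y.
  by case/splitPl: yp => p1 p2 ly; exists p1, p2.
have [s [ps ls szs ms arcss]] := cycle_from cc yc.
move: pp; rewrite Ep cat_path ly => /andP[pp1 pp2].
exists (p1 ++ s ++ p2); split.
- by rewrite !cat_path pp1 ly ps ls pp2.
- by rewrite !last_cat ly ls.
- move=> z; rewrite !inE !mem_cat.
  by case/orP => [->|/orP[|]->] //; rewrite !orbT.
- by move=> z zc; rewrite inE !mem_cat ms zc !orbT.
rewrite !walk_arcs_cat ly ls -catA perm_cat2l.
by rewrite perm_catC perm_cat2l.
Qed.

Lemma splice_all x p cs : path (arc G) x p -> all (is_cycle G) cs ->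
  (forall c, c \in cs -> has (mem c) (x :: p)) ->
  exists q, [/\ path (arc G) x q, last x q = last x p,
    {subset x :: p <= x :: q} &
    perm_eq (walk_arcs x q) (walk_arcs x p ++ arcs_of cs)].
Proof.
elim: cs p => [|c cs IH] p pp; first by exists p; split; rewrite ?cats0.
case/andP=> cc ccs H.
have [q1 [pq1 lq1 sq1 _ Eq1]] := splice pp cc (H c (mem_head _ _)).
have [|q [pq lq sq Eq]] := IH q1 pq1 ccs.
  move=> c' c'cs; have/hasP[y yp yc'] := H c' (mem_behead (s := c :: cs) c'cs).
  by apply/hasP; exists y => //; apply: sq1.
exists q; split=> //; first by rewrite lq.
  by move=> y /sq1/sq.
by rewrite arcs_of_cons (perm_trans Eq) // catA perm_cat2r.
Qed.

End Walks.

(** * Congruences, cyclicity and cyclic classes *)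

(** Numbers in one residue class modulo [g] fall into only [m] classes modulo [g * m], told apart by
    the quotient [f]; the [m + 1] values [F 0], ..., [F m] must therefore collide. *)
Lemma modular_pigeonhole (F : nat -> nat) (g m : nat) : 0 < g -> 0 < m ->
  (forall a b, a <= m -> b <= m -> F a = F b %[mod g]) ->
  exists a b, a < b <= m /\ F a = F b %[mod g * m].
Proof.
move=> g0 m0 Fg; pose f a := (F a %% (g * m)) %/ g.
have /(uniqPn 0)[a [b [ab]]] : ~~ uniq (map f (iota 0 m.+1)).
  apply/negP => u; have := @uniq_leq_size _ _ (iota 0 m) u.
  rewrite size_map !size_iota ltnn => H; suff: false by []; apply: H.
  move=> _ /mapP[a _ ->].
  by rewrite mem_iota /= add0n ltn_divLR // [m * g]mulnC ltn_pmod // muln_gt0 g0.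
rewrite size_map size_iota ltnS => bm.
have am : a <= m by apply: leq_trans bm; apply: ltnW.
rewrite !(nth_map 0) ?size_iota // !nth_iota // !add0n => fab.
exists a, b; split; first by rewrite ab.
rewrite (divn_eq (F a %% _) g) [RHS](divn_eq _ g) -!/(f _) fab.
by rewrite !modn_dvdm ?dvdn_mulr // (Fg a b).
Qed.

(** As soon as [m] elements are kept, two of their [m + 1] prefix sums agree modulo [g * m]; the
    block between them is discarded. *)
Lemma discard_multiples (T : eqType) (f : T -> nat) (g m : nat) (s : seq T) :
  0 < g -> 0 < m -> {in s, forall x, g %| f x} -> exists ks rs,
  [/\ perm_eq s (ks ++ rs), g * m %| sumn (map f rs), size ks < m &
      {in ks, forall x, ~~ (g * m %| f x)}].
Proof.
move=> g0 m0; elim: s => [|x s IH] gs; first by exists [::], [::]; split.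
case: IH => [y ys|ks [rs [ps rsP ksm ksP]]]; first by rewrite gs // inE ys orbT.
have psx : perm_eq (x :: s) (x :: ks ++ rs) by rewrite perm_cons.
have [xP|xP] := boolP (g * m %| f x).
  exists ks, (x :: rs); split=> //=; last by rewrite dvdn_addr.
  by rewrite (perm_trans psx) // perm_sym -cat1s perm_catCA.
have kxP : {in x :: ks, forall y, ~~ (g * m %| f y)}.
  by move=> y; rewrite inE => /orP[/eqP->|/ksP].
have [kxm|mkx] := ltnP (size ks).+1 m; first by exists (x :: ks), rs.
set k := x :: ks in kxP.
have szk : size k = m by rewrite /= ; apply/eqP; rewrite eqn_leq ksm.
have kg : {in k, forall y, g %| f y}.
  by move=> y yk; apply: gs; rewrite (perm_mem psx) -cat_cons mem_cat yk.
have sumg n : g %| sumn (map f (take n k)).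
  rewrite sumnE big_map big_seq; apply: dvdn_sum => y /mem_take; exact: kg.
have [a b _ _|a [b [/andP[ab bm] ]]] :=
    @modular_pigeonhole (fun n => sumn (map f (take n k))) g m g0 m0.
  by rewrite (eqP (sumg a)) (eqP (sumg b)).
have Eb : take b k = take a k ++ take (b - a) (drop a k).
  by rewrite -takeD subnKC // ltnW.
rewrite Eb map_cat sumn_cat -{1}[sumn _]addn0 => /eqP; rewrite eqn_modDl mod0n eq_sym => sP.
exists (take a k ++ drop b k), (take (b - a) (drop a k) ++ rs); split.
- rewrite (perm_trans psx) // -cat_cons -/k -{1}(cat_take_drop b k) Eb -!catA.
  by rewrite perm_cat2l perm_catCA perm_refl.
- by rewrite map_cat sumn_cat dvdn_addr // /dvdn.
- rewrite size_cat size_drop size_takel ?szk; last by apply: leq_trans bm; apply: ltnW.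
  by move: ab bm; lia.
- move=> y; rewrite mem_cat => /orP[/mem_take|/mem_drop]; exact: kxP.
Qed.

Section Cyclicity.
Variables (d : nat) (G : digraph d).
Hypothesis conn : forall x y, connect (arc G) x y.
Implicit Types (x y z : 'I_d) (p q c : seq 'I_d) (cs : seq (seq 'I_d)).
Let g := sc_cyclicity G.

Lemma cycle_size_bound c : uniq c -> size c <= d.
Proof. by move/card_uniqP <-; rewrite (leq_trans (max_card _)) ?card_ord. Qed.

Lemma sc_cyclicity_dvd c : is_cycle G c -> g %| size c.
Proof.
move=> cc; have szc : size c <= d by case/and3P: cc => _ /cycle_size_bound.
exact: (@biggcdn_inf _ (Bseq szc)).
Qed.

Lemma sc_cyclicity_dvd_closed x p : path (arc G) x p -> last x p = x -> g %| size p.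
Proof.
move=> /closed_walk_cycles/[apply]-[cs /allP ccs] /perm_size.
rewrite size_walk_arcs size_arcs_of => ->; rewrite /cycle_sizes sumnE big_map.
rewrite big_seq; apply: dvdn_sum => c /ccs; exact: sc_cyclicity_dvd.
Qed.

Hypothesis g0 : 0 < g.

(* Any [g] consecutive nodes of a walk are in different cyclic classes, so the
   smallest class is met by each of them. *)
Lemma small_class : exists2 K : {set 'I_d}, #|K| <= d %/ g &
  forall x p, path (arc G) x p -> size (x :: p) %/ g <= count (mem K) (x :: p).
Proof.
case: (posnP d) => [d0|d0].
  exists finset.set0 => [|x]; first by rewrite cards0.
  by have := ltn_ord x; rewrite {2}d0.
pose o := Ordinal d0.
have walkP x y : exists2 p, path (arc G) x p & last x p = y.
  by have /connectP[p pp ->] := conn x y; exists p.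
(* [w x] is the length of some walk from [o] to [x]. Its residue modulo [g] does not depend on the
   choice, and the classes [K k] of equal residue are the cyclic classes. *)
have [w wP] : exists w : 'I_d -> nat, forall x,
    exists p, [/\ path (arc G) o p, last o p = x & size p = w x].
  have H x : exists n, exists p, [/\ path (arc G) o p, last o p = x & size p = n].
    by have [p pp lp] := walkP o x; exists (size p), p.
  by exists (fun x => projT1 (cid (H x))) => x; exact: projT2 (cid (H x)).
have wS x y : arc G x y -> w y = (w x).+1 %[mod g].
  move=> xy; have [p [pp lp <-]] := wP x; have [p' [pp' lp' <-]] := wP y.
  (* Closing both walks to [y] by the same return [r] gives closed walks, whose lengths are
     multiples of [g]. *)
  have [r pr lr] := walkP y o.
  have d1 : g %| size (p' ++ r).
    by apply: (@sc_cyclicity_dvd_closed o); rewrite ?cat_path ?pp' ?last_cat lp'.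
  have d2 : g %| size (rcons p y ++ r).
    apply: (@sc_cyclicity_dvd_closed o); last by rewrite last_cat last_rcons.
    by rewrite cat_path last_rcons rcons_path pp lp xy.
  move: d1 d2; rewrite !size_cat size_rcons => /eqP d1 /eqP d2.
  by apply/eqP; rewrite -(eqn_modDr (size r)) d1 d2.
pose K (k : 'I_g) := [set x : 'I_d | w x %% g == k]%SET.
have hit k x p : path (arc G) x p -> size (x :: p) %/ g <= count (mem (K k)) (x :: p).
  have [n] := ubnP (size p); elim: n => // n IH in x p *; rewrite ltnS => szp pp.
  have [lt|ge] := ltnP (size (x :: p)) g; first by rewrite divn_small.
  have nthw t : t < size (x :: p) -> w (nth x (x :: p) t) = w x + t %[mod g].
    elim: t => [|t IHt] lt; first by rewrite addn0.
    have /(_ t)/(_ lt) a := pathP x pp.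
    by rewrite (wS _ _ a) addnS -[(w _).+1]addn1 -modnDml (IHt (ltnW lt)) modnDml addn1.
  (* The number of steps, below [g], after which a walk from [x] is in class [k]; this gives one
     visit in the first [g] nodes, and the induction handles the rest. *)
  pose t := (k + (g - w x %% g)) %% g.
  have tg : t < g by rewrite ltn_pmod.
  have tK : nth x (x :: p) t \in K k.
    have wl : w x %% g <= g by rewrite ltnW // ltn_pmod.
    rewrite inE nthw ?(leq_trans tg) // /t modnDmr.
    have -> : w x + (k + (g - w x %% g)) = (w x %/ g).+1 * g + k.
      by rewrite {1}(divn_eq (w x) g) mulSn; move: wl; lia.
    by rewrite modnMDl modn_small.
  rewrite -{2}(cat_take_drop g (x :: p)) count_cat.
  have c1 : 0 < count (mem (K k)) (take g (x :: p)).
    rewrite -has_count; apply/hasP; exists (nth x (x :: p) t) => //.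
    by rewrite -(nth_take x tg) mem_nth // size_takel.
  have szE : size (x :: p) %/ g = (size (drop g (x :: p)) %/ g).+1.
    by rewrite size_drop -{1}(subnK ge) divnDr // divnn g0 addn1.
  rewrite szE -add1n leq_add //.
  case E : (drop g (x :: p)) => [|y s] //=; first by rewrite div0n.
  have szs : size (y :: s) = size (x :: p) - g by rewrite -E size_drop.
  apply: IH; first by move: szs szp; rewrite /=; lia.
  have : sorted (arc G) (drop g (x :: p)) by apply: drop_sorted.
  by rewrite E.
(* The classes partition the [d] nodes, so not all of them can have more than [d %/ g] nodes. *)
have [k Kk] : exists k : 'I_g, #|K k| <= d %/ g.
  apply: contrapT => H.
  have H' k : (d %/ g).+1 <= #|K k| by rewrite ltnNge; apply/negP => ?; apply: H; exists k.
  have : \sum_(k < g) (d %/ g).+1 <= \sum_(k < g) #|K k| by apply: leq_sum.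
  rewrite sum_nat_const card_ord.
  have -> : \sum_(k < g) #|K k| = d.
    transitivity #|'I_d|; last exact: card_ord.
    rewrite -[RHS]sum1_card.
    rewrite (partition_big (fun x => Ordinal (ltn_pmod (w x) g0)) xpredT) //=.
    by apply: eq_bigr => k _; rewrite -sum1_card; apply: eq_bigl => x; rewrite inE.
  by rewrite mulnC leqNgt ltn_ceil.
exists (K k) => // x p; exact: hit.
Qed.

(** Distances between visits to [u] are lengths of closed walks, hence multiples of [g], and the
    pigeonhole applies to the positions of [m + 1] visits. *)
Lemma repeated_node (m : nat) x p u : 0 < m -> path (arc G) x p ->
  m < count_mem u (x :: p) -> exists s1 s2 s3,
  [/\ p = s1 ++ s2 ++ s3, last x s1 = u, last u s2 = u, 0 < size s2 & g * m %| size s2].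
Proof.
move=> m0 pp mu; pose idx := [seq t <- iota 0 (size p).+1 | nth x (x :: p) t == u].
have szidx : m < size idx.
  rewrite size_filter; move: mu.
  by rewrite -{1}[x :: p](mkseq_nth x) count_map.
have idxP a : a <= m -> nth x (x :: p) (nth 0 idx a) = u /\ nth 0 idx a <= size p.
  move=> am; have : nth 0 idx a \in idx by rewrite mem_nth // (leq_ltn_trans am).
  by rewrite mem_filter mem_iota /= ltnS => /andP[/eqP].
have sidx : sorted ltn idx by apply: sorted_filter (iota_ltn_sorted _ _); exact: ltn_trans.
have idx_lt a b : a < b -> b <= m -> nth 0 idx a < nth 0 idx b.
  move=> ab bm; apply: (sorted_ltn_nth ltn_trans) => //; rewrite inE; lia.
have split_at a b : a < b -> b <= m -> exists s1 s2 s3,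
  [/\ p = s1 ++ s2 ++ s3, last x s1 = u, last u s2 = u &
      size s2 = nth 0 idx b - nth 0 idx a].
  move=> ab bm; have := idx_lt a b ab bm; have [] := idxP b bm.
  have [] := idxP a (leq_trans (ltnW ab) bm).
  set i := nth 0 idx a; set j := nth 0 idx b => ni ip nj jp ij.
  have lastE n : n <= size p -> last x (take n p) = nth x (x :: p) n.
    move=> np; rewrite (last_nth x) size_takel //.
    by case: n np => //= n np; rewrite nth_take.
  exists (take i p), (take (j - i) (drop i p)), (drop j p); split.
  - by rewrite catA -takeD subnKC ?cat_take_drop // ltnW.
  - by rewrite lastE.
  - by rewrite -{1}ni -lastE // -last_cat -takeD subnKC ?lastE // ltnW.
  - by rewrite size_takel // size_drop leq_sub2r.
have closed a b : a < b -> b <= m -> nth 0 idx a = nth 0 idx b %[mod g].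
  move=> ab bm; have [s1 [s2 [s3 [E l1 l2 sz2]]]] := split_at a b ab bm.
  have ij := idx_lt a b ab bm.
  move: pp; rewrite E !cat_path l1 => /and3P[_ ps2 _].
  have := sc_cyclicity_dvd_closed ps2 l2; rewrite sz2 => /eqP ji.
  by apply/eqP; rewrite eq_sym -(subnK (ltnW ij)) -modnDml ji add0n.
have [a b am bm|a [b [/andP[ab bm] Eab]]] :=
    @modular_pigeonhole (fun a => nth 0 idx a) g m g0 m0.
  by case: (ltngtP a b) => [ab|ba|->] //; [|symmetry]; apply: closed.
have [s1 [s2 [s3 [E l1 l2 sz2]]]] := split_at a b ab bm.
exists s1, s2, s3; split; rewrite // sz2; first by rewrite subn_gt0 idx_lt.
by rewrite -eqn_mod_dvd ?Eab // ltnW // idx_lt.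
Qed.

End Cyclicity.

(** * The cycle removal threshold *)

Lemma count_in_set (T : finType) (K : {set T}) (s : seq T) :
  count (mem K) s = \sum_(u in K) count_mem u s.
Proof.
elim: s => [|x s IH] /=; first by rewrite big1.
rewrite big_split /= -IH; congr addn.
have [xK|xK] := boolP (x \in K).
  rewrite (bigD1 x) //= eqxx big1 // => u /andP[_ /negPf ux].
  by rewrite eq_sym ux.
by rewrite big1 // => u uK; case: eqP => // xu; rewrite xu uK in xK.
Qed.

Lemma uniq_count_in_set (T : finType) (K : {set T}) (s : seq T) :
  uniq s -> count (mem K) s = #|K :&: [set x in s]|.
Proof.
move=> us; rewrite -size_filter -(card_uniqP (filter_uniq _ us)).
by apply: eq_card => x; rewrite mem_filter !inE.
Qed.

Section CycleRemoval.
Variables (d : nat) (G : digraph d).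
Hypothesis conn : forall x y, connect (arc G) x y.
Implicit Types (x y z : 'I_d) (p q c : seq 'I_d) (cs : seq (seq 'I_d)).
Let g := sc_cyclicity G.
Hypothesis g0 : 0 < g.
Variable Z : seq 'I_d.
Hypothesis ZG : is_cycle G Z.
Let m := size Z %/ g.
Let r := d %/ g.
Let N := g * (r - 1) ^ 2 + d + g - 1.

Let sizeZ : size Z = g * m.
Proof. by rewrite mulnC divnK // sc_cyclicity_dvd. Qed.

Let m0 : 0 < m.
Proof. by have := cycle_pos ZG; rewrite sizeZ muln_gt0 => /andP[]. Qed.

Lemma cycle_class_count (K : {set 'I_d}) c :
  (forall x p, path (arc G) x p -> size (x :: p) %/ g <= count (mem K) (x :: p)) ->
  is_cycle G c -> size c <= g * count (mem K) c.
Proof.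
move=> hit cc; have cg := sc_cyclicity_dvd cc.
rewrite -(divnK cg) mulnC leq_mul2l; apply/orP; right.
case: c cc cg => // x s /and3P[_ _]; rewrite /path.cycle rcons_path => /andP[xs _] _.
exact: hit.
Qed.

(** The measure adds [size p1] to the length so that reaching [Z] earlier, or moving a closed
    subwalk from before [Z] to after it, is progress too. If no progress is possible, visits to the
    small class [K] are so few that the walk is short. *)
Lemma shorten_walk i p1 p2 : m < r -> path (arc G) i (p1 ++ p2) ->
  last i p1 \in Z -> N < size (p1 ++ p2) ->
  exists p1' p2', [/\ path (arc G) i (p1' ++ p2') /\
    last i (p1' ++ p2') = last i (p1 ++ p2), last i p1' \in Z,
    reduces G i (p1 ++ p2) (p1' ++ p2'),
    size (p1 ++ p2) = size (p1' ++ p2') %[mod g * m] &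
    size (p1' ++ p2') + size p1' < size (p1 ++ p2) + size p1].
Proof.
move=> mr pp lZ; apply: contraPP => H; apply/negP; rewrite -leqNgt.
move: (pp); rewrite cat_path => /andP[pp1 pp2]; set k := last i p1 in lZ pp2.
have nA u : u \in belast i p1 -> u \notin Z.
  move=> ub; apply/negP => uZ; apply: H.
  have [t tp tu] : exists2 t, t < size p1 & nth i (i :: p1) t = u.
    have := nth_index i ub; move: ub; rewrite -index_mem size_belast => lt <-.
    exists (index u (belast i p1)) => //.
    by rewrite lastI nth_rcons size_belast lt.
  exists (take t p1), (drop t p1 ++ p2); rewrite catA cat_take_drop.
  split=> //; last first.
  - by rewrite size_takel ?ltn_add2l // ltnW.
  - exact: reduces_refl.
  rewrite (last_nth i) size_takel ?(ltnW tp) //.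
  by case: t tp tu => [_ /= ->//|t tp /= tu]; rewrite nth_take //= tu.
have nB u : count_mem u (i :: p1) <= m.
  rewrite leqNgt; apply/negP.
  move=> /(repeated_node g0 m0 pp1)[s1 [s2 [s3 [E l1 l2 s20 gs2]]]]; apply: H.
  exists (s1 ++ s3), p2; move: pp lZ pp1 pp2; rewrite /k E !cat_path !last_cat l1 l2.
  move=> /andP[/and3P[ps1 ps2 ps3] pp2] lZ _ _.
  split; rewrite ?ps1 ?ps3 ?pp2 //.
  - by rewrite -!catA; apply: reduces_cut; rewrite l1.
  - rewrite !size_cat -!addnA addnCA -modnDml.
    by move/eqP: gs2 => ->; rewrite add0n.
  - by rewrite !size_cat; clear -s20; lia.
have nC u : count_mem u (k :: p2) <= m.
  rewrite leqNgt; apply/negP.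
  move=> /(repeated_node g0 m0 pp2)[s1 [s2 [s3 [E l1 l2 s20 gs2]]]]; apply: H.
  exists p1, (s1 ++ s3); move: pp; rewrite E !cat_path !last_cat -/k l1 l2.
  move=> /and4P[_ ps1 ps2 ps3].
  split; rewrite ?pp1 ?ps1 ?ps3 //.
  - by rewrite !(catA p1); apply: reduces_cut; rewrite last_cat -/k l1.
  - rewrite !size_cat [size s1 + _]addnCA addnCA -modnDml.
    by move/eqP: gs2 => ->; rewrite add0n.
  - by rewrite !size_cat; clear -s20; lia.
have nD u : u \in k :: p2 -> count_mem u (i :: p1) <= 1.
  move=> uk; rewrite leqNgt; apply/negP.
  (* With [m] equal to 1 a second visit yields a closed subwalk [s2] of arbitrary length. It is
     moved to the visit of [u] in [p2]: the length is unchanged while [p1] shrinks. *)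
  move=> /(repeated_node g0 (ltn0Sn 0) pp1)[s1 [s2 [s3 [E l1 l2 s20 _]]]]; apply: H.
  have [t1 [t2 [E2 lt1]]] : exists t1 t2, p2 = t1 ++ t2 /\ last k t1 = u.
    by case/splitPl: uk pp2 => t1 t2 lt1 _; exists t1, t2.
  have kE : k = last u s3 by rewrite /k E !last_cat l1 l2.
  move: pp1 pp2; rewrite E E2 !cat_path l1 l2 lt1 => /and3P[ps1 ps2 ps3] /andP[pt1 pt2].
  exists (s1 ++ s3), (t1 ++ s2 ++ t2); split.
  - rewrite !cat_path !last_cat l1 l2 -kE lt1 l2 ps1 ps3 pt1 ps2 pt2; by split.
  - by rewrite last_cat l1 -kE.
  - apply: reduces_perm; rewrite !walk_arcs_cat !last_cat l1 l2 -kE lt1 l2 -!catA perm_cat2l.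
    by rewrite perm_catC -!catA perm_cat2l perm_cat2l perm_catC.
  - by rewrite !size_cat; congr modn; clear; lia.
  - by rewrite !size_cat; clear -s20; lia.
have [K Kr hit] := small_class conn g0.
have ip : i :: (p1 ++ p2) = belast i p1 ++ (k :: p2).
  by rewrite -cat_cons lastI -/k cat_rcons.
have belast_le u : count_mem u (belast i p1) <= count_mem u (i :: p1).
  by rewrite lastI -cats1 count_cat leq_addr.
have cntu u : count_mem u (i :: (p1 ++ p2)) <= m + (u \notin Z).
  rewrite ip count_cat; have [uZ|uZ] := boolP (u \in Z).
    have -> : count_mem u (belast i p1) = 0.
      by apply/count_memPn/negP => /nA; rewrite uZ.
    by rewrite add0n addn0.
  have [uk|uk] := boolP (u \in k :: p2).
    by rewrite addnC leq_add //; apply: leq_trans (belast_le u) (nD u uk).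
  rewrite (count_memPn uk) addn0.
  by apply: leq_trans (leq_trans (belast_le u) (nB u)) (leq_addr _ _).
(* A node of [K] contributes at most [m], plus 1 when it is off [Z]. As [Z] contains at least [m]
   nodes of [K], adding [m] to the sum at most replaces the number of nodes of [K] off [Z] by the
   size of [K]. *)
have cntK : count (mem K) (i :: (p1 ++ p2)) + m <= r * m + r.
  have -> : count (mem K) (i :: p1 ++ p2) = \sum_(u in K) count_mem u (i :: p1 ++ p2).
    exact: count_in_set.
  apply: (@leq_trans (\sum_(u in K) (m + (u \notin Z)) + m)).
    by rewrite leq_add2r; apply: leq_sum.
  rewrite big_split /= sum_nat_const.
  have uZ : uniq Z by case/and3P: ZG.
  have := cycle_class_count hit ZG; rewrite sizeZ leq_pmul2l // uniq_count_in_set // => mK.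
  have -> : \sum_(u in K) (u \notin Z : nat) = #|K :\: [set x in Z]|.
    rewrite -big_mkcondr /= sum1_card; apply: eq_card => u.
    by rewrite !inE andbC.
  have := cardsID [set x in Z] K; move: mK Kr; rewrite -/r -/g.
  set a := #|_ :&: _|; set b := #|_ :\: _|; set c := #|K|; clear.
  move: a b c m r => a b c m' r' ma cr abc.
  by rewrite -addnA; apply: leq_add; [rewrite leq_mul | lia].
have := hit i (p1 ++ p2) pp; rewrite -ltnS ltn_divLR // => szp.
have dr : r * g <= d by apply: leq_trunc_div.
rewrite /N; move: szp cntK mr dr m0 g0; rewrite /= -/g.
move: (count _ _) (size _) => c s; clear.
case: r => // r'; rewrite subn1 /=; nia.
Qed.

(** A form of [cycle_edit] in which all inserted cycles are copies of [Z], so that their weight is a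
    multiple of that of [Z]. *)
Definition edits i p q := exists kept cs n,
  [/\ all (is_cycle G) cs, perm_eq (walk_arcs i p) (kept ++ arcs_of cs) &
      perm_eq (walk_arcs i q) (kept ++ arcs_of (nseq n Z))].

Lemma edits_reduces i p q : reduces G i p q -> edits i p q.
Proof.
move=> [cs ccs E]; exists (walk_arcs i q), cs, 0; split=> //.
by rewrite cats0.
Qed.

Lemma cycle_removal_short i p : m < r -> path (arc G) i p ->
  has (mem Z) (i :: p) -> exists q,
  [/\ path (arc G) i q /\ last i q = last i p, has (mem Z) (i :: q),
      reduces G i p q, size q = size p %[mod size Z] & size q <= N].
Proof.
move=> mr pp /hasP[k kp kZ].
have [p1 [p2 [Ep lp1]]] : exists p1 p2, p = p1 ++ p2 /\ last i p1 = k.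
  by case/splitPl: kp pp => p1 p2 lp1 _; exists p1, p2.
move: kZ pp; rewrite -lp1 {}Ep => {lp1 kp k}.
have [n] := ubnP (size (p1 ++ p2) + size p1).
elim: n => // n IH in p1 p2 *; rewrite ltnS => szn lZ pp.
have [le|lt] := leqP (size (p1 ++ p2)) N.
  exists (p1 ++ p2); split=> //; last exact: reduces_refl.
  apply/hasP; exists (last i p1) => //.
  by rewrite -cat_cons mem_cat mem_last.
have [p1' [p2' [[pp' lp'] lZ' red' sz' lt']]] :=
  shorten_walk mr pp lZ lt.
have [|q [[pq lq] Zq redq szq leq]] := IH p1' p2' _ lZ' pp'.
  exact: leq_trans lt' szn.
exists q; split=> //; first by rewrite lq lp'.
  exact: reduces_trans red' redq.
by rewrite szq sizeZ sz'.
Qed.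

Lemma size_cycles_le cs b : {in cs, forall c, size c <= b} ->
  cycle_sizes cs <= size cs * b.
Proof.
rewrite /cycle_sizes; elim: cs => //= c cs IH cb; rewrite mulSn leq_add ?cb ?mem_head //.
by apply: IH => c' c'cs; rewrite cb // inE c'cs orbT.
Qed.

Lemma uniq_size_disjoint p q : uniq p -> uniq q -> ~~ has (mem p) q ->
  size p + size q <= d.
Proof.
move=> up uq pq; rewrite -size_cat cycle_size_bound // cat_uniq up uq andbT.
exact: pq.
Qed.

(** Serves to find a removed cycle meeting the base walk: otherwise the nodes of the base would be
    closed under the arcs of the original walk, and would contain all its nodes. *)
Lemma walk_arcs_closed (B : pred 'I_d) i p x : x \in i :: p ->
  (forall a, a \in walk_arcs i p -> a.1 \in B -> a.2 \in B) ->
  i \in B -> x \in B.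
Proof.
elim: p i => [|y p IH] i; first by rewrite inE => /eqP->.
rewrite inE => /orP[/eqP->//|xp] inB iB; apply: IH xp _ _ => [a ai|].
  by apply: inB; rewrite walk_arcs_cons inE ai orbT.
by apply: (inB (i, y)) => //; rewrite walk_arcs_cons mem_head.
Qed.

(* When [Z] has maximal length it contains the smallest cyclic class, so that
   it meets all cycles. *)
Lemma cycle_removal_long i p : r <= m -> path (arc G) i p ->
  has (mem Z) (i :: p) -> exists q,
  [/\ path (arc G) i q /\ last i q = last i p, has (mem Z) (i :: q),
      edits i p q, size q = size p %[mod size Z] & size q <= N].
Proof.
move=> rm pp pZ; have [K Kr hit] := small_class conn g0.
have d0 : 0 < d by case: i {pp pZ} => j; case: (d).
have uc c : is_cycle G c -> uniq c by case/and3P.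
have ccK := cycle_class_count hit.
have cK s : uniq s -> count (mem K) s <= r.
  move=> us; apply: leq_trans Kr; rewrite uniq_count_in_set //.
  exact: subset_leq_card (finset.subsetIl _ _).
have Er : m = r.
  apply/eqP; rewrite eqn_leq rm andbT -(leq_pmul2l g0) -sizeZ.
  by apply: leq_trans (ccK _ ZG) _; rewrite leq_mul2l cK ?orbT ?uc.
have KZ : K \subset [set x in Z].
  apply/finset.setIidPl/eqP; rewrite eqEcard finset.subsetIl -uniq_count_in_set ?uc //.
  apply: leq_trans Kr _; rewrite -/r -Er -(leq_pmul2l g0) -sizeZ.
  exact: ccK.
have meetZ c : is_cycle G c -> has (mem Z) c.
  move=> cc; have : 0 < count (mem K) c.
    by have := leq_trans (cycle_pos cc) (ccK _ cc); rewrite muln_gt0 => /andP[].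
  rewrite -has_count => /hasP[x xc xK]; apply/hasP; exists x => //.
  by have := fintype.subsetP KZ _ xK; rewrite inE.
have sz_le c : is_cycle G c -> size c <= size Z.
  move=> cc; apply: leq_trans (ccK _ cc) _.
  by rewrite sizeZ Er leq_mul2l cK ?orbT ?uc.
(* The base is the loop-erased walk if that meets [Z]; otherwise one removed cycle [c1] is spliced
   in to reach [Z]. The last property reserves room for any cycle [e] missing the base. *)
have [b [cs [[pb lb] bZ ccs Ep [szb szbe]]]] : exists b cs,
    [/\ path (arc G) i b /\ last i b = last i p, has (mem Z) (i :: b),
        all (is_cycle G) cs, perm_eq (walk_arcs i p) (walk_arcs i b ++ arcs_of cs) &
        size b < d /\ forall e, is_cycle G e -> ~~ has (mem e) (i :: b) ->
          size e + size b < d].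
  have [b [cs [pb lb ub ccs Ep]]] := loop_erasure pp.
  have szb : size b < d by have := cycle_size_bound ub.
  have [bZ|bZ] := boolP (has (mem Z) (i :: b)).
    exists b, cs; split=> //; split=> // e ce eb.
    by have := uniq_size_disjoint (uc _ ce) ub eb; rewrite /= addnS.
  have [c1 c1cs c1b] : exists2 c, c \in cs & has (mem c) (i :: b).
    apply: contrapT => H.
    have inb a : a \in walk_arcs i p -> a.1 \in i :: b -> a.2 \in i :: b.
      rewrite (perm_mem Ep) mem_cat => /orP[/mem_walk_arcs_snd|].
        by move=> ab _; rewrite inE ab orbT.
      case/flatten_mapP => c ccs'; case/mapP => x xc -> /= xb.
      by case: H; exists c => //; apply/hasP; exists x.
    case/negP: bZ; case/hasP: pZ => x xp xZ; apply/hasP; exists x => //.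
    exact: walk_arcs_closed xp inb (mem_head _ _).
  have cc1 := allP ccs _ c1cs.
  have [b' [pb' lb' sb' sc1 Eb']] := splice pb cc1 c1b.
  have szb' : size b' = size b + size c1.
    by have := perm_size Eb'; rewrite size_cat !size_walk_arcs size_map.
  have szbZ : size Z + size b < d.
    by have := uniq_size_disjoint (uc _ ZG) ub bZ; rewrite /= addnS.
  exists b', (rem c1 cs); split.
  - by rewrite lb'.
  - have /hasP[x xc1 xZ] := meetZ _ cc1; apply/hasP; exists x => //; exact: sc1.
  - by apply/allP => c /mem_rem/(allP ccs).
  - rewrite (perm_trans Ep) // perm_sym.
    have := perm_arcs_of (perm_to_rem c1cs); rewrite perm_sym => Ers.
    rewrite (perm_trans (y := (walk_arcs i b ++ cycle_arcs c1) ++ arcs_of (rem c1 cs))) //.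
      by rewrite perm_cat2r.
    by rewrite -catA perm_cat2l.
  split.
    by rewrite szb' addnC; apply: leq_ltn_trans szbZ; rewrite leq_add2r sz_le.
  move=> e ce eb'.
  (* The disjoint cycles [e] and [c1] share the at most [r] nodes of [K], and each has length at
     most [g] times its number of nodes in [K]. *)
  have : size e + size c1 <= size Z.
    rewrite sizeZ Er; apply: leq_trans (leq_add (ccK _ ce) (ccK _ cc1)) _.
    rewrite -mulnDr leq_mul2l -count_cat cK ?orbT // cat_uniq !uc //= andbT.
    by apply: contra eb' => /hasP[x xc1 xe]; apply/hasP; exists x => //; apply: sc1.
  by move=> ?; rewrite szb' addnCA addnC; apply: leq_ltn_trans szbZ; rewrite leq_add2r.
have [c cin|ks [rs [pcs rsP szks ksP]]] :=
    @discard_multiples _ size g m cs g0 m0.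
  exact: (sc_cyclicity_dvd (allP ccs _ cin)).
have cks : all (is_cycle G) ks.
  by apply/allP => c ck; apply: (allP ccs); rewrite (perm_mem pcs) mem_cat ck.
have crs : all (is_cycle G) rs.
  by apply/allP => c ck; apply: (allP ccs); rewrite (perm_mem pcs) mem_cat ck orbT.
(* The length of a kept cycle is a multiple of [g], at most [g * r], and not divisible by
   [g * r]. *)
have ks_le : {in ks, forall c, size c <= g * (r - 1)}.
  move=> c ck; have cc := allP cks _ ck; have := sz_le _ cc; have := ksP _ ck.
  rewrite sizeZ Er; have /dvdnP[t ->] := sc_cyclicity_dvd cc.
  rewrite -/g [t * g]mulnC dvdn_pmul2l // !leq_pmul2l // => nd.
  have : t != r by apply: contraNneq nd => ->.
  by clear; lia.
have Ep2 : perm_eq (walk_arcs i p) ((walk_arcs i b ++ arcs_of ks) ++ arcs_of rs).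
  by rewrite (perm_trans Ep) // -catA perm_cat2l -arcs_of_cat perm_arcs_of.
have szp : size p = size b + cycle_sizes ks + cycle_sizes rs.
  by have := perm_size Ep2; rewrite !size_cat !size_walk_arcs !size_arcs_of.
have ksb : {in ks, forall c, has (mem c) (i :: b)} \/ 
    exists2 e, e \in ks & ~~ has (mem e) (i :: b).
  case: (boolP (all (fun c => has (mem c) (i :: b)) ks)) => [/allP|/allPn[e]].
    by left.
  by right; exists e.
(* If all kept cycles meet the base, they are spliced into it: fewer than [r] cycles of length at
   most [g * (r - 1)] are added to fewer than [d] arcs. *)
case: ksb => [ksb|[e eks eb]].
  have [q [pq lq sq Eq]] := splice_all pb cks ksb.
  have szq : size q = size b + cycle_sizes ks.
    by have := perm_size Eq; rewrite size_cat !size_walk_arcs size_arcs_of.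
  exists q; split=> //; first by rewrite lq.
  - by case/hasP: bZ => x xb xZ; apply/hasP; exists x => //; apply: sq.
  - exists (walk_arcs i b ++ arcs_of ks), rs, 0; split=> //.
    by rewrite cats0.
  - rewrite szq szp -(modnDmr _ (cycle_sizes rs)) sizeZ.
    by move/eqP: rsP => ->; rewrite addn0.
  have := size_cycles_le ks_le; rewrite szq /N; move: szks szb g0; rewrite Er.
  move: (size b) (cycle_sizes ks) (size ks) => sb sk nk; clear.
  case: r => // r'; rewrite subn1 /= -mulnn => nkr sbd g0 skb.
  have : sk <= g * (r' * r').
    by apply: leq_trans skb _; rewrite mulnCA leq_mul2l leq_mul2r -ltnS nkr !orbT.
  by clear -sbd g0; lia.
(* Otherwise [Z] is inserted first, and every kept cycle meets it. The cycle [e] and the base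
   together have length below [d], which pays for [Z]. *)
have [q0 [pq0 lq0 sq0 sZq0 Eq0]] := splice pb ZG bZ.
have [|q [pq lq sq Eq]] := splice_all pq0 cks.
  move=> c ck; have /hasP[x xc xZ] := meetZ _ (allP cks _ ck).
  by apply/hasP; exists x => //; apply: sZq0.
have szq : size q = size b + size Z + cycle_sizes ks.
  have := perm_size Eq; rewrite size_cat !size_walk_arcs size_arcs_of => ->.
  by have := perm_size Eq0; rewrite size_cat !size_walk_arcs size_map => ->.
exists q; split=> //; first by rewrite lq lq0.
- by case/hasP: bZ => x xb xZ; apply/hasP; exists x => //; apply: sq; apply: sq0.
- exists (walk_arcs i b ++ arcs_of ks), rs, 1; split=> //.
  rewrite (perm_trans Eq) //.
  have -> : arcs_of (nseq 1 Z) = cycle_arcs Z by rewrite /arcs_of /= cats0.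
  rewrite (perm_trans (y := (walk_arcs i b ++ cycle_arcs Z) ++ arcs_of ks)) //.
    by rewrite perm_cat2r.
  by rewrite -!catA perm_cat2l perm_catC.
- rewrite szq szp -(modnDmr _ (cycle_sizes rs)) sizeZ.
  by move/eqP: rsP => ->; rewrite addn0 addnAC modnDr.
have ks' : cycle_sizes ks <= size e + (size ks - 1) * (g * (r - 1)).
  have := perm_to_rem eks => pe.
  have -> : cycle_sizes ks = size e + cycle_sizes (rem e ks).
    by rewrite /cycle_sizes (perm_sumn (perm_map size pe)).
  rewrite leq_add2l [size ks - 1]subn1 -(size_rem eks).
  by apply: size_cycles_le => c /mem_rem; apply: ks_le.
have := szbe e (allP cks _ eks) eb.
have nk0 : 0 < size ks by case: (ks) eks.
move: ks' szks nk0 g0; rewrite szq /N sizeZ Er.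
move: (size b) (cycle_sizes ks) (size ks) (size e) => sb sk nk se; clear.
case: nk => // nk; case: r => // r'; rewrite !subn1 /= -mulnn => skb nkr _ g0 seb.
have : nk * (g * r') + g * r' <= g * (r' * r').
  by rewrite -mulSnr mulnCA leq_mul2l leq_mul2r -ltnS nkr !orbT.
by rewrite mulnS; clear -skb seb g0; lia.
Qed.

End CycleRemoval.

(** One less than the bound on [T1]; the difference is the 1 added to the cycle removal
    threshold. *)
Definition cycle_removal_bound (d g : nat) := g * (d %/ g - 1) ^ 2 + d + g - 1.

Theorem cycle_removal (d : nat) (G : digraph d) (Z : seq 'I_d) i p :
  (forall x y, connect (arc G) x y) -> 0 < sc_cyclicity G -> is_cycle G Z ->
  path (arc G) i p -> has (mem Z) (i :: p) -> exists q,
  [/\ path (arc G) i q /\ last i q = last i p, has (mem Z) (i :: q),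
      edits G Z i p q, size q = size p %[mod size Z] &
      size q <= cycle_removal_bound d (sc_cyclicity G)].
Proof.
move=> conn g0 ZG pp pZ.
have [mr|rm] := ltnP (size Z %/ sc_cyclicity G) (d %/ sc_cyclicity G).
  have [q [? ? /edits_reduces red ? ?]] := cycle_removal_short conn g0 ZG mr pp pZ.
  by exists q; split.
exact: cycle_removal_long.
Qed.

Lemma arc_on_cycle (d : nat) (G : digraph d) x y :
  arc G x y -> connect (arc G) y x -> exists2 c, is_cycle G c & x \in c.
Proof.
move=> xy /connectP[s ys lx].
have xs : path (arc G) x (y :: s) by rewrite /= xy.
have [cs ccs E] := closed_walk_cycles xs (esym lx).
have : (x, y) \in walk_arcs x (y :: s) by rewrite walk_arcs_cons mem_head.
rewrite (perm_mem E) => /flatten_mapP[c ccs' /mapP[x' x'c [-> _]]].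
by exists c => //; apply: (allP ccs).
Qed.

Lemma is_cycle_cycle_graph (d : nat) (c : seq 'I_d) :
  c != [::] -> uniq c -> is_cycle (cycle_graph c) c.
Proof.
move=> c0 uc; rewrite /is_cycle c0 uc /=.
by apply: cycle_from_next => // x xc; rewrite /= xc eqxx.
Qed.

(** * Thresholds of irreducible matrices *)

Section Irreducible.
Variables (R : realType) (d : nat) (A : 'M[\bar R]_d).
Hypothesis irrA : irreducible A.
Let G := graph A.
Let g := sc_cyclicity G.

Lemma irreducible_connect x y : connect (arc G) x y.
Proof. by case: irrA => _ + _; apply; rewrite inE. Qed.

Lemma irreducible_cycle x : exists2 c, is_cycle G c & x \in c.
Proof.
suff [y xy] : exists y, arc G x y by apply: arc_on_cycle xy (irreducible_connect _ _).
(* A walk to another node starts with an arc out of [x]. If [x] is the only node, it carries a loop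
   because the matrix with single entry [-oo] is excluded. *)
have [[y yx]|H] := pselect (exists y, y != x).
  have /connectP[[|z s] /=] := irreducible_connect x y.
    by move=> _ yE; rewrite yE eqxx in yx.
  by case/andP=> xz _ _; exists z.
have xE y : y = x by apply: contrapT => /eqP yx; apply: H; exists y.
exists x; case: irrA => d0 _ nA; apply/negP => /eqP Axx; apply: nA; split.
  apply/eqP; rewrite eqn_leq d0 andbT -(card_ord d).
  by apply/card_le1P => y _ z; rewrite !inE (xE y) (xE z) eqxx.
by move=> i j; rewrite (xE i) (xE j).
Qed.

Lemma irreducible_cyclicity : 0 < g.
Proof.
have d0 : 0 < d by case: irrA.
have [c cc _] := irreducible_cycle (Ordinal d0).
have := sc_cyclicity_dvd cc; rewrite -/g lt0n; apply: contraTneq => ->.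
by rewrite dvd0n -lt0n (cycle_pos cc).
Qed.

Lemma Tcr_bound Z : is_cycle G Z ->
  (Tcr (size Z) A (cycle_graph Z) <= (cycle_removal_bound d g)%:R%:E)%E.
Proof.
move=> cZ; apply: ereal_inf_lbound => /=; exists (cycle_removal_bound d g) => //.
move=> i j p /andP[pp /eqP lp] pZ _.
have {}pZ : has (mem Z) (i :: p).
  by move: pZ; rewrite /goes_through; congr is_true; apply: eq_has => x; rewrite /= inE.
have [q [[pq lq] qZ [kept [cs [n [ccs Ep Eq]]]] szq leq]] :=
  cycle_removal irreducible_connect irreducible_cyclicity cZ pp pZ.
exists q; split=> //.
- by rewrite /walk pq lq lp eqxx.
- by move: qZ; rewrite /goes_through; congr is_true; apply: eq_has => x; rewrite /= inE.
exists kept, cs, (nseq n Z); split=> //.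
apply/allP => c /nseqP[-> _]; apply: is_cycle_cycle_graph; first by case/and3P: cZ.
by case/and3P: cZ.
Qed.

Lemma T1_bound B (G' : digraph d) : subgraph G' G ->
  (T1 A B <= \big[maxe/-oo]_(Z : d.-bseq 'I_d | is_cycle G' Z)
                  (Tcr (size Z) A (cycle_graph Z) + 1) ->
   T1 A B <= (cycle_removal_bound d g + 1)%:R%:E)%E.
Proof.
move=> [_ sG _] /le_trans; apply; apply/bigmax_leP; split=> [|Z cZ].
  exact: leNye.
rewrite natrD EFinD leeD2r // Tcr_bound //.
case/and3P: cZ => Z0 uZ cZ; rewrite /is_cycle Z0 uZ.
exact: sub_cycle cZ.
Qed.
End Irreducible.

(** * Weights of walks and max-plus powers *)

Section ArcWeights.
Variables (R : realType) (d : nat).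
Implicit Types (w : 'I_d -> 'I_d -> R) (s : seq ('I_d * 'I_d)).
Local Open Scope ring_scope.

Definition arc_weight w s : R := \sum_(a <- s) w a.1 a.2.

Lemma arc_weight_nil w : arc_weight w [::] = 0.
Proof. by rewrite /arc_weight big_nil. Qed.

Lemma arc_weight_cat w s1 s2 :
  arc_weight w (s1 ++ s2) = arc_weight w s1 + arc_weight w s2.
Proof. by rewrite /arc_weight big_cat. Qed.

Lemma perm_arc_weight w s1 s2 : perm_eq s1 s2 -> arc_weight w s1 = arc_weight w s2.
Proof. by move=> s12; apply: perm_big. Qed.

Lemma arc_weight_shift w (mu : R) s :
  arc_weight (fun x y => w x y - mu) s = arc_weight w s - mu * (size s)%:R.
Proof.
by rewrite /arc_weight sumrB big_const_seq count_predT iter_addr_0 mulr_natr.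
Qed.

Lemma arc_weight_cycles_le0 w cs :
  {in cs, forall c, arc_weight w (cycle_arcs c) <= 0} -> arc_weight w (arcs_of cs) <= 0.
Proof.
elim: cs => [|c cs IH] H; first by rewrite arc_weight_nil.
rewrite arcs_of_cons arc_weight_cat -[0]addr0 lerD ?H ?mem_head //.
by apply: IH => c' c's; rewrite H // inE c's orbT.
Qed.

Lemma arc_weight_nseq w n c :
  arc_weight w (arcs_of (nseq n c)) = arc_weight w (cycle_arcs c) *+ n.
Proof.
elim: n => [|n IH]; first by rewrite arc_weight_nil.
by rewrite [nseq _ _]/= arcs_of_cons arc_weight_cat IH mulrS.
Qed.

End ArcWeights.

Section Represents.
Variables (R : realType) (d : nat) (e : rel 'I_d) (w : 'I_d -> 'I_d -> R).
Implicit Types (M : 'M[\bar R]_d).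
Local Open Scope ereal_scope.

(** [M x y] is the largest weight of a walk of length [n] from [x] to [y], or [-oo] if there is
    none: the first half gives the upper bound on weights, the second its attainment. *)
Definition represents M n :=
  (forall x p, path e x p -> size p = n ->
     (arc_weight w (walk_arcs x p))%:E <= M x (last x p)) /\
  (forall x y, M x y != -oo -> exists p,
     [/\ path e x p, last x p = y, size p = n & M x y = (arc_weight w (walk_arcs x p))%:E]).

Lemma mp_mul_ge M1 M2 i j k : M1 i k + M2 k j <= mp_mul M1 M2 i j.
Proof. by rewrite mxE; apply: (le_bigmax_cond _ (fun k => M1 i k + M2 k j)). Qed.

Lemma mp_mul_attained M1 M2 i j : exists k, mp_mul M1 M2 i j = M1 i k + M2 k j.
Proof.
rewrite mxE; have [//|k _|k _ ->] := @eq_bigmax _ _ _ (-oo) i xpredT (fun k => M1 i k + M2 k j).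
  exact: leNye.
by exists k.
Qed.

Lemma represents_arcs M : (forall x y, e x y -> M x y = (w x y)%:E) ->
  (forall x y, ~~ e x y -> M x y = -oo) -> represents M 1.
Proof.
move=> Me Mn; split=> [x [|y [|]] //= /andP[xy _] _|x y Mxy].
  by rewrite Me // lee_fin /arc_weight big_seq1.
have xy : e x y by apply: contraNT Mxy => /Mn ->.
exists [:: y]; split; rewrite //= ?xy //.
by rewrite Me // /arc_weight big_seq1.
Qed.

Lemma represents_one : represents (mp_one R d) 0.
Proof.
split=> [x [|//] _ _ /=|x y]; first by rewrite mxE eqxx arc_weight_nil.
rewrite mxE; have [->|_] := eqVneq x y; last by rewrite eqxx.
move=> _.
by exists [::]; split=> //; rewrite arc_weight_nil.
Qed.

Lemma represents_mul M1 M2 a b : represents M1 a -> represents M2 b ->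
  represents (mp_mul M1 M2) (a + b).
Proof.
move=> [lb1 at1] [lb2 at2]; split=> [x p pp szp|x y].
  move: pp; rewrite -(cat_take_drop a p) cat_path => /andP[pp1 pp2].
  rewrite walk_arcs_cat arc_weight_cat last_cat EFinD.
  apply: le_trans (mp_mul_ge _ _ _ _ (last x (take a p))); apply: leeD.
    by apply: lb1 => //; rewrite size_takel // szp leq_addr.
  by apply: lb2 => //; rewrite size_drop szp addKn.
have [k ->] := mp_mul_attained M1 M2 x y => Mxy.
have [|p1 [pp1 lp1 sz1 E1]] := at1 x k.
  by apply: contraNneq Mxy => ->.
have [|p2 [pp2 lp2 sz2 E2]] := at2 k y.
  by apply: contraNneq Mxy => ->; rewrite addeNy.
exists (p1 ++ p2); rewrite cat_path last_cat size_cat walk_arcs_cat arc_weight_cat.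
by rewrite lp1 pp1 pp2 lp2 sz1 sz2 E1 E2 EFinD.
Qed.

Lemma represents_pow M a t : represents M a -> represents (mp_pow M t) (t * a).
Proof.
move=> Ma; elim: t => [|t IH]; first exact: represents_one.
by rewrite mulSn; apply: represents_mul.
Qed.

End Represents.

Lemma ereal_sup_adde_le (R : realType) (f : nat -> \bar R) (b c : \bar R) :
  (forall n, f n + b <= c)%E -> (ereal_sup (range f) + b <= c)%E.
Proof.
move=> H; case: b H => [b| |] H.
- rewrite -leeBrDr //; apply: ge_ereal_sup => _ [n _ <-].
  by rewrite leeBrDr.
- have [f0|/existsNP[n /eqP fn]] := pselect (forall n, f n = -oo%E).
    suff -> : ereal_sup (range f) = -oo%E by rewrite addNye leNye.
    by apply/eqP; rewrite -leeNy_eq; apply: ge_ereal_sup => _ [n _ <-]; rewrite f0.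
  have := H n; rewrite addey // leye_eq => /eqP->.
  exact: leey.
- by rewrite addeNy leNye.
Qed.

(** * Graphs spanned by families of cycles *)

Section CycleSpan.
Variables (R : realType) (d : nat) (A : 'M[\bar R]_d) (P : pred (seq 'I_d)).
Implicit Types (x y : 'I_d) (c : seq 'I_d).

Lemma cycle_span_arcP x y : arc (cycle_span A P) x y ->
  exists c, [/\ is_cycle (graph A) c, P c, x \in c & next c x = y].
Proof. by case/existsP => c /and4P[cc Pc xc /eqP cxy]; exists c. Qed.

Lemma cycle_span_nodeP x : x \in nodes (cycle_span A P) ->
  exists c, [/\ is_cycle (graph A) c, P c & x \in c].
Proof. by rewrite inE => /existsP[c /and3P[]]; exists c. Qed.

Lemma cycle_span_node c x : is_cycle (graph A) c -> P c -> x \in c ->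
  x \in nodes (cycle_span A P).
Proof.
move=> cc Pc xc; have szc : size c <= d by case/and3P: cc => _ /cycle_size_bound.
by rewrite inE; apply/existsP; exists (Bseq szc); rewrite /= cc Pc.
Qed.

Lemma cycle_span_arc c x : is_cycle (graph A) c -> P c -> x \in c ->
  arc (cycle_span A P) x (next c x).
Proof.
move=> cc Pc xc; have szc : size c <= d by case/and3P: cc => _ /cycle_size_bound.
by apply/existsP; exists (Bseq szc); rewrite /= cc Pc xc eqxx.
Qed.

Lemma cycle_span_cycle c : is_cycle (graph A) c -> P c -> is_cycle (cycle_span A P) c.
Proof.
move=> cc Pc; have /and3P[c0 uc _] := cc; rewrite /is_cycle c0 uc /=.
by apply: cycle_from_next => // x; apply: cycle_span_arc.
Qed.

Lemma cycle_span_sub x y : arc (cycle_span A P) x y -> arc (graph A) x y.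
Proof.
by move=> /cycle_span_arcP[c [/and3P[_ _ cc] _ xc <-]]; apply: next_cycle cc xc.
Qed.

Lemma cycle_span_path_node x p y : x \in nodes (cycle_span A P) ->
  path (arc (cycle_span A P)) x p -> y \in x :: p -> y \in nodes (cycle_span A P).
Proof.
elim: p x => [|z p IH] x xn /=; first by rewrite inE => _ /eqP->.
case/andP=> xz zp; rewrite inE => /orP[/eqP->//|yp]; apply: IH zp yp.
have [c [cc Pc xc <-]] := cycle_span_arcP xz.
by apply: cycle_span_node cc Pc _; rewrite mem_next.
Qed.

End CycleSpan.

(** * Cycle means and the exchange of cycles *)

Section CycleMeans.
Variables (R : realType) (d : nat) (A : 'M[\bar R]_d).
Hypotheses (hA : over_Rmax A) (irrA : irreducible A).
Implicit Types (x y : 'I_d) (c p q : seq 'I_d).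
Let G := graph A.
Let N := cycle_removal_bound d (sc_cyclicity G).
Local Open Scope ring_scope.

(** Real arc weights normalized by [mu]: a cycle has mean at most [mu] exactly when its total excess
    is at most 0. On arcs [fine] loses nothing, since entries are never [+oo]. *)
Definition excess (mu : R) x y := fine (A x y) - mu.

Lemma excessE mu s :
  arc_weight (excess mu) s = arc_weight (excess 0) s - mu * (size s)%:R.
Proof.
rewrite -arc_weight_shift /excess; apply: eq_bigr => x _ /=.
by rewrite subr0.
Qed.

Lemma arcE x y : arc G x y -> A x y = (excess 0 x y)%:E.
Proof.
by move=> xy; rewrite /excess subr0 fineK // fin_numE; apply/andP; split; [|apply: hA].
Qed.

Lemma cycle_meanE c : is_cycle G c ->
  cycle_mean A c = (arc_weight (excess 0) (cycle_arcs c) / (size c)%:R)%:E.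
Proof.
case/and3P=> _ uc cc; rewrite EFinM /cycle_mean; congr (_ * _)%E.
rewrite /arc_weight big_map -sumEFin big_seq [RHS]big_seq.
by apply: eq_bigr => x xc; rewrite arcE //; apply: next_cycle cc xc.
Qed.

Lemma cycle_mean_le mu c : is_cycle G c ->
  (cycle_mean A c <= mu%:E)%E = (arc_weight (excess mu) (cycle_arcs c) <= 0).
Proof.
move=> cc; rewrite cycle_meanE // lee_fin [in RHS]excessE subr_le0 size_map.
by rewrite ler_pdivrMr // ltr0n (cycle_pos cc).
Qed.

Lemma cycle_mean_eq mu c : is_cycle G c ->
  (cycle_mean A c == mu%:E) = (arc_weight (excess mu) (cycle_arcs c) == 0).
Proof.
move=> cc; rewrite cycle_meanE // eqe [in RHS]excessE subr_eq0 size_map.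
by rewrite -(inj_eq (mulIf (x := (size c)%:R) _)) ?mulfVK // pnatr_eq0 -lt0n (cycle_pos cc).
Qed.

Lemma max_cycle_mean_ge c : is_cycle G c -> (cycle_mean A c <= max_cycle_mean A)%E.
Proof.
move=> cc; have szc : (size c <= d)%N by case/and3P: cc => _ /cycle_size_bound.
exact: (le_bigmax_cond _ (fun c : d.-bseq 'I_d => cycle_mean A c) (j := Bseq szc)).
Qed.

Lemma max_cycle_mean_fin : max_cycle_mean A \is a fin_num.
Proof.
have d0 : (0 < d)%N by case: irrA.
have [c cc _] := irreducible_cycle irrA (Ordinal d0).
have szc : (size c <= d)%N by case/and3P: cc => _ /cycle_size_bound.
rewrite /max_cycle_mean.
have [|c' _|c' cc' ->] := @eq_bigmax _ _ _ (-oo)%E (Bseq szc)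
  (fun c : d.-bseq 'I_d => is_cycle G c) (fun c : d.-bseq 'I_d => cycle_mean A c).
- exact: cc.
- exact: leNye.
- by rewrite cycle_meanE.
Qed.

(* Cycles of the walk [p] are traded for copies of the cycle [Z] of larger
   mean, at least one of which is inserted. *)
Lemma replace_cycles mu Z i p t : is_cycle G Z -> cycle_mean A Z = mu%:E ->
  path (arc G) i p -> has (mem Z) (i :: p) ->
  (forall c, is_cycle G c -> has (mem c) (i :: p) -> (cycle_mean A c <= mu%:E)%E) ->
  (N < t)%N -> size p = t %[mod size Z] ->
  exists q, [/\ path (arc G) i q, last i q = last i p, size q = t,
    {subset Z <= i :: q} &
    arc_weight (excess mu) (walk_arcs i p) <= arc_weight (excess mu) (walk_arcs i q)].
Proof.
move=> cZ muZ pp pZ pmu Nt szp.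
have [q [[pq lq] qZ [kept [cs [n [ccs Ep Eq]]]] szq leq]] :=
  cycle_removal (irreducible_connect irrA) (irreducible_cyclicity irrA) cZ pp pZ.
have qt : (size q < t)%N by apply: leq_ltn_trans Nt.
(* The missing length is a positive multiple of [size Z]. One copy of [Z] is spliced in first, which
   brings all its nodes into the walk, and the other [k] follow. *)
have /dvdnP[[|k] Ek] : (size Z %| t - size q)%N.
- by rewrite -eqn_mod_dvd ?(ltnW qt) // szq szp.
- by move: qt; rewrite -subn_gt0 Ek.
have [q1 [pq1 lq1 _ sZq1 Eq1]] := splice pq cZ qZ.
have [||q2 [pq2 lq2 sq2 Eq2]] := @splice_all _ G i q1 (nseq k Z) pq1.
- by apply/allP => c /nseqP[->].
- move=> c /nseqP[-> _]; apply/hasP; case/hasP: qZ => x _ xZ.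
  by exists x => //; apply: sZq1.
have wZ : arc_weight (excess mu) (cycle_arcs Z) = 0.
  by apply/eqP; rewrite -cycle_mean_eq // muZ.
exists q2; split=> //.
- by rewrite lq2 lq1.
- have := perm_size Eq2; rewrite size_cat !size_walk_arcs size_arcs_of => ->.
  have := perm_size Eq1; rewrite size_cat !size_walk_arcs size_map => ->.
  rewrite /cycle_sizes map_nseq sumn_nseq -addnA [(_ * k)%N]mulnC -mulSn -Ek.
  by rewrite subnKC // ltnW.
- by move=> x xZ; apply: sq2; apply: sZq1.
rewrite (perm_arc_weight _ Eq2) arc_weight_cat (perm_arc_weight _ Eq1) arc_weight_cat.
rewrite (perm_arc_weight _ Eq) (perm_arc_weight _ Ep) !arc_weight_cat !arc_weight_nseq wZ.
rewrite !mul0rn !addr0 gerDl; apply: arc_weight_cycles_le0 => c ccs'.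
have cc := allP ccs _ ccs'.
rewrite -cycle_mean_le //; apply: pmu => //.
have [x xc] : exists x, x \in c by case: c cc {ccs'} => // x s _; exists x; rewrite mem_head.
apply/hasP; exists x => //; apply: (@mem_walk_arcs_fst _ _ _ (x, next c x)).
rewrite (perm_mem Ep) mem_cat; apply/orP; right.
by apply/flatten_mapP; exists c => //; apply: map_f.
Qed.

End CycleMeans.

(** * The critical graph and CSR terms *)

Lemma sccsP (d : nat) (G : digraph d) (X : {set 'I_d}) : X \in sccs G ->
  exists2 x, x \in nodes G & X = [set y in nodes G | same_scc G x y]%SET.
Proof. by case/imsetP => x xG ->; exists x. Qed.

Lemma scc_of (d : nat) (G : digraph d) x : x \in nodes G ->
  [set y in nodes G | same_scc G x y]%SET \in sccs G.
Proof. by move=> xG; apply/imsetP; exists x. Qed.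

Lemma iterate_closed_walk (d : nat) (e : rel 'I_d) x p n :
  path e x p -> last x p = x ->
  path e x (flatten (nseq n p)) /\ last x (flatten (nseq n p)) = x.
Proof.
move=> pp lp; elim: n => // n [IHp IHl].
by rewrite /= cat_path last_cat lp pp.
Qed.

Section Critical.
Variables (R : realType) (d : nat) (A : 'M[\bar R]_d).
Hypotheses (hA : over_Rmax A) (irrA : irreducible A).
Implicit Types (x y k : 'I_d) (c p q s : seq 'I_d).
Let G := graph A.
Let C := critical_graph A.
Let N := cycle_removal_bound d (sc_cyclicity G).
Let sigma := cyclicity C.
Let lam := fine (max_cycle_mean A).
Let w := excess A lam.
Let weight x p := arc_weight w (walk_arcs x p).
Local Open Scope ring_scope.

Let lamE : max_cycle_mean A = lam%:E.
Proof. by rewrite fineK // max_cycle_mean_fin. Qed.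

Let weight_cat x p q : weight x (p ++ q) = weight x p + weight (last x p) q.
Proof. by rewrite /weight walk_arcs_cat arc_weight_cat. Qed.

Let weight_cons x y p : weight x (y :: p) = w x y + weight y p.
Proof. by rewrite /weight walk_arcs_cons /arc_weight big_cons. Qed.

Lemma critical_sub x y : arc C x y -> arc G x y.
Proof. exact: cycle_span_sub. Qed.

Lemma closed_walk_le0 x p : path (arc G) x p -> last x p = x -> weight x p <= 0.
Proof.
move=> pp lp; have [cs ccs E] := closed_walk_cycles pp lp.
rewrite /weight (perm_arc_weight _ E); apply: arc_weight_cycles_le0 => c ccs'.
have cc := allP ccs _ ccs'; rewrite -cycle_mean_le // -lamE.
exact: max_cycle_mean_ge.
Qed.

Lemma critical_cycle_through x : x \in nodes C -> exists c, [/\ is_cycle G c,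
  cycle_mean A c = lam%:E, is_cycle C c, x \in c & arc_weight w (cycle_arcs c) = 0].
Proof.
move=> /cycle_span_nodeP[c [cc /eqP mc xc]]; exists c; split=> //.
- by rewrite mc.
- by apply: cycle_span_cycle => //; apply/eqP.
- by apply/eqP; rewrite -cycle_mean_eq // mc lamE.
Qed.

(** Each arc of the critical graph lies on a critical cycle, whose remainder leads back and cancels
    the normalized weight of the arc. *)
Lemma critical_return x u : path (arc C) x u -> exists v,
  [/\ path (arc C) (last x u) v, last (last x u) v = x &
      weight x u + weight (last x u) v = 0].
Proof.
elim: u x => [|y u IH] x.
  by exists [::]; split; rewrite // /weight arc_weight_nil addr0.
case/andP=> xy /IH[v [pv lv wv]]; rewrite last_cons.
have [c [cc mc xc cxy]] := cycle_span_arcP xy.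
have cC : is_cycle C c by apply: cycle_span_cycle.
have [p [pp lp szp _ Ep]] := cycle_from cC xc.
have wp : weight x p = 0.
  apply/eqP; rewrite /weight (perm_arc_weight _ Ep) -cycle_mean_eq // -lamE.
  exact: mc.
case: p pp lp szp Ep wp => [|y' p]; first by move=> _ _ /esym; have := cycle_pos cc; case: (size c).
move=> pp lp _ Ep; have y'E : y' = y.
  have : (x, y') \in walk_arcs x (y' :: p) by rewrite walk_arcs_cons mem_head.
  by rewrite (perm_mem Ep) => /mapP[x' _ [<- ->]].
move: pp lp; rewrite {Ep y'}y'E weight_cons => /= /andP[_ pp] lp wp.
exists (v ++ p); rewrite cat_path last_cat lv pv pp lp weight_cons weight_cat lv.
by split=> //; move: wv wp; lra.
Qed.

(** The walk and its return are both closed, so neither has positive weight; their weights add up to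
    0. *)
Lemma critical_closed_walk x p : path (arc C) x p -> last x p = x -> weight x p = 0.
Proof.
move=> pp lp; have [v [pv lv wv]] := critical_return pp.
move: pv lv wv; rewrite lp => pv lv wv.
have w1 : weight x p <= 0 by apply: closed_walk_le0 lp; apply: sub_path pp; exact: critical_sub.
have w2 : weight x v <= 0 by apply: closed_walk_le0 lv; apply: sub_path pv; exact: critical_sub.
by apply/eqP; rewrite eq_le w1 -wv gerDl.
Qed.

Lemma cycle_in_scc c x : is_cycle C c -> x \in c -> x \in nodes C ->
  is_cycle (induced C [set y in nodes C | same_scc C x y]%SET) c.
Proof.
move=> cc xc xC; have /and3P[c0 uc pc] := cc; rewrite /is_cycle c0 uc /=.
have cX y : y \in c -> y \in [set y in nodes C | same_scc C x y]%SET.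
  move=> yc; rewrite inE /same_scc !(connect_cycle pc) // !andbT.
  have [p [pp lp _ pE _]] := cycle_from cc xc.
  by apply: (cycle_span_path_node xC pp); rewrite inE pE yc orbT.
apply: cycle_from_next => // y yc; apply/and3P; split; rewrite ?cX ?mem_next //.
exact: next_cycle pc yc.
Qed.

Lemma critical_cyclicity : (0 < sigma)%N.
Proof.
apply: (big_ind (fun n => 0 < n)%N) => // [m n m0 n0|X /sccsP[x xC ->]].
  by rewrite lcmn_gt0 m0.
have [c [_ _ cC xc _]] := critical_cycle_through xC.
have := sc_cyclicity_dvd (cycle_in_scc cC xc xC).
rewrite lt0n; apply: contraTneq => ->.
by rewrite dvd0n -lt0n (cycle_pos cC).
Qed.

(* The lengths, modulo [l], of the closed walks of weight 0 at a critical node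
   form a group, which contains the lengths of all cycles of its component. *)
Lemma critical_loops k l n : k \in nodes C -> (0 < l)%N -> (sigma %| n)%N ->
  exists s, [/\ path (arc G) k s, last k s = k, 0 <= weight k s & size s = n %[mod l]].
Proof.
move=> kC l0; pose S n := exists s,
  [/\ path (arc G) k s, last k s = k, 0 <= weight k s & size s = n %[mod l]].
(* Modulo [l], the factor [l - 1] acts as -1, so that closure under addition gives closure under
   differences and, by Bezout, under gcds. *)
have El : (l - 1).+1 = l by rewrite subn1 prednK.
have S0 : S 0%N by exists [::]; split; rewrite // /weight arc_weight_nil.
have SD m1 m2 : S m1 -> S m2 -> S (m1 + m2)%N.
  move=> [s1 [p1 l1 w1 z1]] [s2 [p2 l2 w2 z2]]; exists (s1 ++ s2); split.
  - by rewrite cat_path l1 p1.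
  - by rewrite last_cat l1.
  - by rewrite weight_cat l1 addr_ge0.
  - by rewrite size_cat -modnDm z1 z2 modnDm.
have SM m1 m2 : S m1 -> S (m2 * m1)%N.
  by move=> Sm; elim: m2 => // m2 IH; rewrite mulSn; apply: SD.
have Seq m1 m2 : m1 = m2 %[mod l] -> S m1 -> S m2.
  by move=> E [s [? ? ? z]]; exists s; split=> //; rewrite z.
have Sgcd m1 m2 : S m1 -> S m2 -> S (gcdn m1 m2).
  have [->|m10] := posnP m1; first by rewrite gcd0n.
  have [km kn E _] := egcdnP m2 m10 => S1 S2.
  apply: (Seq (km * m1 + (kn * (l - 1)) * m2)%N); last by apply: SD; apply: SM.
  rewrite E; have -> : (kn * m2 + gcdn m1 m2 + kn * (l - 1) * m2 =
      (kn * m2) * l + gcdn m1 m2)%N by rewrite -[in RHS]El; clear; nia.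
  by rewrite modnMDl.
suff Sg : S (sc_cyclicity (induced C [set y in nodes C | same_scc C k y]%SET)).
  move=> sn; have /dvdnP[j ->] : (sc_cyclicity
      (induced C [set y in nodes C | same_scc C k y]%SET) %| n)%N.
    apply: dvdn_trans sn; exact: (biglcmn_sup _ (scc_of kC)).
  exact: SM.
apply: (big_ind S) => // c cc.
have cC : is_cycle C c.
  case/and3P: cc => c0 uc pc; rewrite /is_cycle c0 uc; apply: sub_cycle pc.
  by move=> x y /and3P[].
have /hasP[y yc _] : has predT c by rewrite has_predT (cycle_pos cC).
have : connect (arc C) k y.
  case/and3P: cc => _ _ pc; have /and3P[_] := next_cycle pc yc.
  by rewrite inE => /andP[_ /andP[]].
case/connectP => u pu ly; rewrite {}ly in yc.
have [v [pv lv wuv]] := critical_return pu.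
have [p [pp lp szp _ _]] := cycle_from cC yc.
have pC s : path (arc C) k s -> last k s = k -> S (size s).
  move=> ps ls; exists s; split=> //; first by apply: sub_path ps; exact: critical_sub.
  by rewrite critical_closed_walk.
(* The cycle [c] is reached along [u] and left along [v]; its length is the difference between the
   loops with and without it. *)
have S1 : S (size u + size v)%N.
  by rewrite -size_cat; apply: pC; rewrite ?cat_path ?last_cat ?pu.
have S2 : S (size u + size c + size v)%N.
  rewrite -szp -!size_cat; apply: pC; first by rewrite !cat_path last_cat lp pu pp.
  by rewrite !last_cat lp.
apply: (Seq ((size u + size c + size v) + (l - 1) * (size u + size v))%N).
  have -> : (size u + size c + size v + (l - 1) * (size u + size v) =
      (size u + size v) * l + size c)%N.
    by rewrite -[in RHS]El; clear; nia.
  by rewrite modnMDl.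
by apply: SD => //; apply: SM.
Qed.

(** A loop at [k] of nonnegative weight corrects the length modulo that of a critical cycle [Z]
    through [k]; then cycles are exchanged for copies of [Z]. *)
Lemma walk_of_critical x p k t : path (arc G) x p -> k \in x :: p -> k \in nodes C ->
  (N < t)%N -> size p = t %[mod sigma] -> exists q,
  [/\ path (arc G) x q, last x q = last x p, size q = t & weight x p <= weight x q].
Proof.
move=> pp kp kC Nt szp.
have [Z [cZ mZ _ kZ _]] := critical_cycle_through kC.
have l0 := cycle_pos cZ; set l := size Z in l0.
have s0 : (0 < sigma)%N := critical_cyclicity.
(* The loop length [t + size p * (sigma * l - 1)] is congruent to [t - size p] modulo [l], and is a
   multiple of [sigma]. *)
have E : (size p + (t + size p * (sigma * l - 1)) = size p * (sigma * l) + t)%N.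
  have sl : (sigma * l - 1).+1 = (sigma * l)%N by rewrite subn1 prednK // muln_gt0 s0.
  by rewrite -[in RHS]sl mulnS -addnA [(_ * _ + t)%N]addnC.
have sn : (sigma %| t + size p * (sigma * l - 1))%N.
  have : (size p + (t + size p * (sigma * l - 1)) == size p + 0 %[mod sigma])%N.
    by rewrite E mulnCA mulnC modnMDl addn0 szp.
  by rewrite eqn_modDl mod0n.
have [s [ps ls ws szs]] := critical_loops kC l0 sn.
have [p1 [p2 [Ep lp1]]] : exists p1 p2, p = p1 ++ p2 /\ last x p1 = k.
  by case/splitPl: kp pp szp E sn szs => p1 p2 lp1; exists p1, p2.
move: (pp); rewrite Ep cat_path lp1 => /andP[pp1 pp2].
have pG : path (arc G) x (p1 ++ s ++ p2) by rewrite !cat_path pp1 lp1 ps ls.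
have szG : size (p1 ++ s ++ p2) = t %[mod l].
  rewrite !size_cat addnCA -size_cat -Ep -modnDml szs modnDml addnC E.
  by rewrite mulnA modnMDl.
have kG : has (mem Z) (x :: p1 ++ s ++ p2).
  by apply/hasP; exists k => //; rewrite -lp1 -cat_cons mem_cat mem_last.
have [|q [pq lq szq _ wq]] := replace_cycles hA irrA cZ mZ pG kG _ Nt szG.
  by move=> c cc _; rewrite -lamE max_cycle_mean_ge.
exists q; split=> //; first by rewrite lq !last_cat lp1 ls.
by apply: le_trans wq; rewrite -!/(weight _ _) !weight_cat lp1 ls lerD2l lerDr.
Qed.

Let Mn n := mp_pow (mp_pow (mp_scale (- max_cycle_mean A) A) sigma) n.

Let represents_Mn n : represents (arc G) w (Mn n) (n * (sigma * 1)).
Proof.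
do 2!apply: represents_pow; apply: represents_arcs => x y xy; rewrite mxE.
  by rewrite lamE arcE // -EFinN -EFinD /w /excess; congr EFin; ring.
by move: xy; rewrite negbK => /eqP ->; rewrite addeNy.
Qed.

Let represents_S : represents (arc C) w (csr_S A) 1.
Proof.
apply: represents_arcs => x y xy; rewrite mxE.
  rewrite ifT // lamE arcE //; last exact: critical_sub xy.
  by rewrite -EFinN -EFinD /w /excess; congr EFin; ring.
by rewrite ifF //; apply: negbTE.
Qed.

Let csr_M_ge n x y : (Mn n x y <= csr_M A x y)%E.
Proof. by rewrite mxE; apply: ereal_sup_ubound; exists n. Qed.

(** A critical loop of weight 0 is inserted at [k] and cut in three. The middle piece, as long as
    [p], is read in [S]; the outer pieces extend the two halves of [p] to lengths divisible by
    [sigma], read in [C] and [R]. *)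
Lemma csr_ge x p k : path (arc G) x p -> k \in x :: p -> k \in nodes C ->
  ((weight x p)%:E <= csr A (size p) x (last x p))%E.
Proof.
move=> pp kp kC.
have [Z [cZ mZ cCZ kZ wZ]] := critical_cycle_through kC.
have [z [pz lz szz _ Ez]] := cycle_from cCZ kZ.
have l0 := cycle_pos cZ; set l := size Z in l0 szz.
have s0 : (0 < sigma)%N := critical_cyclicity.
have [p1 [p2 [Ep lp1]]] : exists p1 p2, p = p1 ++ p2 /\ last x p1 = k.
  by case/splitPl: kp pp => p1 p2 lp1; exists p1, p2.
have /andP[pp1 pp2] : path (arc G) x p1 && path (arc G) k p2 by rewrite -lp1 -cat_path -Ep.
set a := size p1; set b := size p2; pose L := (sigma * l - 1)%N.
have LE : (sigma * l = L.+1)%N by rewrite /L subn1 prednK // muln_gt0 s0.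
(* This many turns have total length [(a + b) * (L + 1)], which splits as [a * L], [a + b] and
   [b * L]; the outer lengths become [a * (L + 1)] and [b * (L + 1)]. *)
have [pv lv] := iterate_closed_walk ((a + b) * sigma) pz lz.
have szv : size (flatten (nseq ((a + b) * sigma) z)) = (a * L + (a + b) + b * L)%N.
  rewrite size_flatten /shape map_nseq sumn_nseq szz mulnCA [(l * _)%N]mulnC LE.
  by clear; nia.
have wv : weight k (flatten (nseq ((a + b) * sigma) z)) = 0.
  exact: critical_closed_walk.
move: pv lv szv wv; set v := flatten _ => pv lv szv wv.
pose v1 := take (a * L) v; pose v2 := take (a + b) (drop (a * L) v).
pose v3 := drop (a + b) (drop (a * L) v).
have Ev : v = v1 ++ v2 ++ v3 by rewrite !cat_take_drop.
have sz1 : size v1 = (a * L)%N by rewrite size_takel // szv -addnA leq_addr.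
have sz2 : size v2 = (a + b)%N.
  by rewrite size_takel // size_drop szv -addnA addKn leq_addr.
have sz3 : size v3 = (b * L)%N by rewrite !size_drop szv -addnA !addKn.
move: (pv) lv wv; rewrite Ev !cat_path !last_cat !weight_cat => /and3P[pv1 pv2 pv3].
set k1 := last k v1; set k2 := last k1 v2 => lv wv.
have kCv y : y \in k :: v -> y \in nodes C by apply: cycle_span_path_node.
have k1C : k1 \in nodes C.
  by apply: kCv; rewrite Ev -cat_cons mem_cat mem_last.
have k2C : k2 \in nodes C.
  by apply: kCv; rewrite Ev catA -cat_cons mem_cat /k2 /k1 -last_cat mem_last.
have sub u q : path (arc C) u q -> path (arc G) u q.
  by apply: sub_path; exact: critical_sub.
have H1 : ((weight x (p1 ++ v1))%:E <= csr_C A x k1)%E.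
  rewrite mxE k1C; apply: le_trans (csr_M_ge (a * l) x k1).
  have [lb _] := represents_Mn (a * l); have := lb x (p1 ++ v1).
  rewrite last_cat lp1; apply; first by rewrite cat_path pp1 lp1 sub.
  by rewrite size_cat sz1 muln1 -mulnA [(l * _)%N]mulnC LE mulnS.
have H2 : ((weight k1 v2)%:E <= mp_pow (csr_S A) (size p) k1 k2)%E.
  have [lb _] := represents_pow (size p) represents_S; apply: lb => //.
  by rewrite sz2 Ep size_cat muln1.
have H3 : ((weight k2 (v3 ++ p2))%:E <= csr_R A k2 (last x p))%E.
  rewrite mxE k2C; apply: le_trans (csr_M_ge (b * l) k2 _).
  have [lb _] := represents_Mn (b * l); have := lb k2 (v3 ++ p2).
  rewrite last_cat lv Ep last_cat lp1; apply; first by rewrite cat_path sub // lv.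
  by rewrite size_cat sz3 muln1 -mulnA [(l * _)%N]mulnC LE mulnS addnC.
have -> : (weight x p)%:E =
    ((weight x (p1 ++ v1))%:E + (weight k1 v2)%:E + (weight k2 (v3 ++ p2))%:E)%E.
  rewrite -!EFinD Ep !weight_cat lv lp1; congr EFin; move: wv.
  by rewrite -/k1 -/k2; lra.
apply: le_trans (mp_mul_ge _ _ _ _ k2); apply: leeD => //.
by apply: le_trans (mp_mul_ge _ _ _ _ k1); apply: leeD.
Qed.

Lemma csr_le t x y : (N < t)%N ->
  (t%:R%:E * max_cycle_mean A + csr A t x y <= mp_pow A t x y)%E.
Proof.
move=> Nt; have tl : (t%:R%:E * max_cycle_mean A = (t%:R * lam)%:E)%E by rewrite lamE.
(* With the scalar moved to the right, the suprema in [C] and [R] can be bounded term by term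
   against the constant [U]. *)
rewrite tl -leeBrDl //; set U := (_ - _)%E.
have [k2 ->] := mp_mul_attained (mp_mul (csr_C A) (mp_pow (csr_S A) t)) (csr_R A) x y.
have [k1 ->] := mp_mul_attained (csr_C A) (mp_pow (csr_S A) t) x k2.
rewrite !mxE; case: ifP => k1C; last by rewrite !addNye leNye.
case: ifP => k2C; last by rewrite addeNy leNye.
rewrite -addeA; apply: ereal_sup_adde_le => n1.
rewrite addeA addeC; apply: ereal_sup_adde_le => n2.
rewrite -!/(Mn _).
have [_ at1] := represents_Mn n1; have [_ at3] := represents_Mn n2.
have [_ at2] := represents_pow t represents_S.
have [->|/at1[p1 [pp1 lp1 sz1 ->]]] := eqVneq (Mn n1 x k1) -oo%E.
  by rewrite addNye addeNy leNye.
have [->|/at3[p3 [pp3 lp3 sz3 ->]]] := eqVneq (Mn n2 k2 y) -oo%E.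
  by rewrite addNye leNye.
have [->|/at2[p2 [pp2 lp2 sz2 ->]]] := eqVneq (mp_pow (csr_S A) t k1 k2) -oo%E.
  by rewrite !addeNy leNye.
have pp : path (arc G) x (p1 ++ p2 ++ p3).
  rewrite !cat_path pp1 lp1 lp2 pp3 andbT; apply: sub_path pp2; exact: critical_sub.
(* The outer pieces have lengths divisible by [sigma], so the concatenated walk has length congruent
   to [t]. *)
have [||q [pq lq szq wq]] := walk_of_critical pp (k := k1) _ k1C Nt.
- by rewrite -lp1 -cat_cons mem_cat mem_last.
- by rewrite !size_cat sz1 sz2 sz3 !muln1 modnMDl addnC modnMDl.
apply: (@le_trans _ _ (weight x q)%:E).
  rewrite -!EFinD lee_fin; apply: le_trans wq; rewrite !weight_cat lp1 lp2 /weight.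
  by rewrite [X in X <= _]addrC -addrA.
have [lb _] := represents_pow t (represents_arcs (fun x y => @arcE _ _ A hA x y)
  (fun x y (nxy : ~~ arc G x y) => eqP (negbNE nxy))).
have := lb x q pq; rewrite muln1 szq => /(_ erefl) wA.
rewrite /U leeBrDr // -EFinD; move: wA; rewrite lq !last_cat lp1 lp2 lp3; apply: le_trans.
rewrite lee_fin /weight /w excessE size_walk_arcs szq.
by rewrite mulrC subrK.
Qed.

End Critical.

(** * The cycle threshold scheme *)

Lemma sccs_same (d : nat) (G : digraph d) X x y :
  X \in sccs G -> x \in X -> y \in X -> same_scc G x y.
Proof.
case/sccsP => z _ ->; rewrite !finset.in_set => /andP[_ /andP[zx xz]] /andP[_ /andP[zy yz]].
by apply/andP; split; [apply: connect_trans xz zy | apply: connect_trans yz zx].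
Qed.

Section CycleThreshold.
Variables (R : realType) (d : nat) (A : 'M[\bar R]_d).
Hypotheses (hA : over_Rmax A) (irrA : irreducible A).
Implicit Types (x y z : 'I_d) (c p q s : seq 'I_d).
Let G := graph A.
Let C := critical_graph A.
Let N := cycle_removal_bound d (sc_cyclicity G).
Let weight x p := arc_weight (excess A 0) (walk_arcs x p).
Local Open Scope ring_scope.

Lemma Tct_connect_le mu nu x y : (mu <= nu)%E ->
  connect (arc (Tct A nu)) x y -> connect (arc (Tct A mu)) x y.
Proof.
move=> mn; apply: connect_sub => u v uv; apply: connect1.
have [c [cc nc uc <-]] := cycle_span_arcP uv.
by apply: cycle_span_arc => //; apply: le_trans mn nc.
Qed.

Lemma Gct_nodeP x : x \in Gct_nodes A -> exists2 y, y \in nodes C & same_scc (ct_graph A) x y.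
Proof.
case/finset.bigcupP => X /andP[XG /finset.set0Pn[y]].
rewrite finset.in_setI => /andP[yX yC] xX; exists y => //; exact: sccs_same XG xX yX.
Qed.

Lemma ct_graph_cycle mu x : ct_admissible A mu -> x \in Gct_nodes A ->
  exists c, [/\ is_cycle G c, (mu_ct A <= cycle_mean A c)%E & x \in c].
Proof.
move=> adm; rewrite /Gct_nodes /ct_graph; case: asboolP => [_|]; last by case; exists mu.
case/finset.bigcupP => X /andP[/sccsP[z zn ->] _].
by rewrite inE => /andP[/cycle_span_nodeP + _].
Qed.

(* Among the walks under consideration and the cycles meeting one of them, take
   a cycle of maximal mean [mu]. It is joined to the critical graph by cycles
   of mean at least [mu], into which the walk can be moved one after another
   since none of its own cycles is better. *)
Lemma walk_to_critical x p v : path (arc G) x p -> (N < size p)%N ->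
  v \in x :: p -> v \in Gct_nodes A -> exists q k,
  [/\ path (arc G) x q, last x q = last x p, size q = size p,
      weight x p <= weight x q & k \in x :: q /\ k \in nodes C].
Proof.
move=> pp Np vp vG; pose W q := [/\ path (arc G) x q, last x q = last x p,
  size q = size p & weight x p <= weight x q].
have Wp : W p by split.
pose P (c : d.-bseq 'I_d) := is_cycle G c && `[< exists2 q, W q & has (mem c) (x :: q) >].
have bseqW c q : is_cycle G c -> W q -> has (mem c) (x :: q) ->
    exists2 b : d.-bseq 'I_d, P b & val b = c.
  move=> cc Wq cq; have szc : (size c <= d)%N by case/and3P: cc => _ /cycle_size_bound.
  by exists (Bseq szc) => //; rewrite /P /= cc; apply/asboolP; exists q.
have [b0 Pb0 _] : exists2 b : d.-bseq 'I_d, P b & true.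
  have [c cc xc] := irreducible_cycle irrA x.
  have [|b Pb _] := bseqW c p cc Wp; last by exists b.
  by rewrite /= xc.
have [Z /andP[cZ /asboolP[qZ WqZ hZ]] maxZ] :=
  arg_maxP (fun c : d.-bseq 'I_d => cycle_mean A c) Pb0.
set mu := cycle_mean A Z in maxZ.
have maxmu c q : is_cycle G c -> W q -> has (mem c) (x :: q) -> (cycle_mean A c <= mu)%E.
  by move=> cc Wq cq; have [b Pb <-] := bseqW c q cc Wq cq; apply: maxZ.
have [q0 [z [k [Wq0 zq0 kC zk]]]] : exists q z k,
    [/\ W q, z \in x :: q, k \in nodes C & connect (arc (Tct A mu)) z k].
  (* If [mu] is admissible then [mu <= mu_ct A], and the connection of [v] to the critical graph
     inside the threshold graph persists for [mu]. If not, the component of [Z] in [Tct A mu]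
     contains a critical component. *)
  have [adm|nadm] := pselect (ct_admissible A mu).
    have [c [cc muc vc]] := ct_graph_cycle adm vG.
    have [k kC /andP[vk _]] := Gct_nodeP vG; exists p, v, k; split=> //.
    move: vk; rewrite /ct_graph; case: asboolP => [_|]; last by case; exists mu.
    by apply: Tct_connect_le; apply: ereal_sup_ubound.
  case/hasP: hZ => z zq zZ.
  have zT : z \in nodes (Tct A mu) by apply: (@cycle_span_node _ _ _ _ (val Z)); rewrite ?lexx.
  have [k kC zk] : exists2 k, k \in nodes C & same_scc (Tct A mu) z k.
    apply: contrapT => H; apply: nadm; split; first exact: max_cycle_mean_ge.
    exists [set y in nodes (Tct A mu) | same_scc (Tct A mu) z y]%SET; first exact: scc_of.
    move=> Y /sccsP[k kC ->]; apply/negP => /fintype.subsetP/(_ k) sub.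
    apply: H; exists k => //; have : k \in [set y in nodes C | same_scc C k y]%SET.
      by rewrite finset.in_set kC /same_scc connect0.
    by move/sub; rewrite finset.in_set => /andP[].
  by exists qZ, z, k; split=> //; case/andP: zk.
case/connectP: zk => s zs ks; rewrite {}ks in kC.
suff [q Wq kq] : exists2 q, W q & last z s \in x :: q.
  by case: Wq => ? ? ? ?; exists q, (last z s); split.
(* The path [s] is followed arc by arc: each arc lies on a cycle of mean at least [mu], hence equal
   to [mu] by maximality, and exchanging cycles for it brings the next node into the walk. *)
elim: s z q0 Wq0 zq0 zs {kC} => [|z' s IH] z q Wq zq; first by exists q.
case/andP=> zz' zs; rewrite last_cons.
have [c [cc muc zc nc]] := cycle_span_arcP zz'.
have cq : has (mem c) (x :: q) by apply/hasP; exists z.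
have Ec : cycle_mean A c = mu by apply/eqP; rewrite eq_le muc (maxmu _ q).
have muE : mu = (fine mu)%:E by rewrite /mu cycle_meanE.
have [pq lq szq wq] := Wq; have Nq : (N < size q)%N by rewrite szq.
have [||q' [pq' lq' szq' sc wq']] :=
    @replace_cycles _ _ A hA irrA (fine mu) c x q (size q) cc _ pq cq _ Nq erefl.
- by rewrite -muE.
- by move=> c' cc' cq'; rewrite -muE; apply: maxmu cq'.
apply: (IH z' q') => //; last by apply: sc; rewrite -nc mem_next.
split=> //; rewrite ?lq' ?szq' //.
apply: le_trans wq _; move: wq'; rewrite !(excessE A (fine mu)) !size_walk_arcs szq'.
by rewrite lerD2r.
Qed.

Lemma erased_B_CT : erased A (B_CT A).
Proof. by move=> i j; rewrite mxE; case: ifP; [right | left]. Qed.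

Lemma erased_represents B : erased A B ->
  represents (arc (graph B)) (excess A 0) B 1.
Proof.
move=> eAB; apply: represents_arcs => x y; last by rewrite negbK => /eqP.
move=> xy; have Bxy : B x y != -oo%E := xy.
by case: (eAB x y) Bxy => -> // Axy; apply: arcE.
Qed.

Lemma B_CT_walk x p : path (arc G) x p -> ~~ has (mem (Gct_nodes A)) (x :: p) ->
  path (arc (graph (B_CT A))) x p.
Proof.
move=> pp; rewrite -all_predC => np; apply: sub_in_path np pp => u v uG vG uv.
change (B_CT A u v != -oo%E); rewrite mxE.
by rewrite ifF //; apply/negbTE; rewrite negb_or; apply/andP; split.
Qed.

Lemma CT_expansion t : (N < t)%N ->
  mp_pow A t = mp_add (mp_scale (t%:R%:E * max_cycle_mean A)%E (csr A t)) (mp_pow (B_CT A) t).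
Proof.
move=> Nt; apply/matrixP => x y; rewrite [RHS]mxE [mp_scale _ _ x y]mxE.
have [lbA atA] : represents (arc G) (excess A 0) (mp_pow A t) (t * 1).
  by apply: represents_pow; apply: erased_represents => i j; left.
have [lbB atB] := represents_pow t (erased_represents erased_B_CT).
apply/eqP; rewrite eq_le; apply/andP; split; last first.
  rewrite ge_max csr_le //=.
  have [->|/atB[p [pp <- szp ->]]] := eqVneq (mp_pow (B_CT A) t x y) -oo%E.
    exact: leNye.
  apply: lbA => //; apply: sub_path pp => u v uv.
  have Buv : B_CT A u v != -oo%E := uv.
  change (A u v != -oo%E).
  by case: (erased_B_CT u v) Buv => [<-|->]; rewrite ?eqxx.
have [->|/atA[p [pp <- szp ->]]] := eqVneq (mp_pow A t x y) -oo%E.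
  exact: leNye.
rewrite le_max; rewrite muln1 in szp.
have [/hasP[v vp vG]|np] := boolP (has (mem (Gct_nodes A)) (x :: p)); last first.
  by rewrite lbB ?orbT ?muln1 //; apply: B_CT_walk.
have Np : (N < size p)%N by rewrite szp.
have [q [k [pq lq szq wq [kq kC]]]] := walk_to_critical pp Np vp vG.
apply/orP; left; have := csr_ge hA irrA pq kq kC.
rewrite lq szq szp -(fineK (max_cycle_mean_fin hA irrA)); set lam := fine _ => H.
apply: (@le_trans _ _ (weight x q)%:E); first by rewrite lee_fin.
apply: le_trans (leeD2l _ H); rewrite -EFinM -EFinD lee_fin excessE size_walk_arcs szq szp.
by rewrite addrC mulrC subrK.
Qed.

Lemma T1_B_CT_bound : (T1 A (B_CT A) <= (N + 1)%:R%:E)%E.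
Proof.
apply: ereal_inf_lbound => /=; exists (N + 1)%N => // t; rewrite addn1.
exact: CT_expansion.
Qed.

End CycleThreshold.

Local Open Scope ring_scope.
Local Open Scope ereal_scope.

Theorem theorem5p5 (R : realType) (d : nat) (A : 'M[\bar R]_d)
    (hA : over_Rmax A) (hirr : irreducible A) :
  let gamma := sc_cyclicity (graph A) in
  let bound := (gamma * (d %/ gamma - 1) ^ 2 + d + gamma)%N in
  (forall (B : 'M[\bar R]_d) (G : digraph d),
     erased A B ->
     subgraph G (graph A) ->
     completely_reducible G ->
     (exists c : seq 'I_d, is_cycle G c) ->
     T1 A B <= \big[maxe/-oo]_(Z : d.-bseq 'I_d | is_cycle G Z)
                  (Tcr (size Z) A (cycle_graph Z) + 1) ->
     T1 A B <= bound%:R%:E) /\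
  T1 A (B_CT A) <= bound%:R%:E.
Proof.
move=> gamma bound.
(* Positivity of [gamma] makes the truncated subtraction in [cycle_removal_bound] exact. *)
have -> : bound = (cycle_removal_bound d gamma + 1)%N.
  have g0 : (0 < gamma)%N := irreducible_cyclicity hirr.
  by rewrite /bound /cycle_removal_bound subnK // addn_gt0 g0 orbT.
split; last exact: T1_B_CT_bound.
by move=> B G _ sG _ _; apply: T1_bound.
Qed.
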